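(* Let $A \in L(\mathcal{H})$ have closed range and let $W \in L(\mathcal{H})^{+}$ be such that $W^{1/2} \in S_p$ for some $p$ with $1 \leq p < \infty$. Then the minimum $$\min_{X \in L(\mathcal{H})} \Vert AX-I\Vert_{p,W}$$ exists (i.e. is attained) if and only if the pair $(W,R(A))$ is compatible. In this case, $$\min_{X \in L(\mathcal{H})} \Vert AX-I\Vert_{p,W} = \Vert W_{/R(A)}^{1/2}\Vert_p .$$ Moreover, in this case, $X_0 \in L(\mathcal{H})$ satisfies $\Vert AX_0-I\Vert_{p,W} = \Vert W_{/R(A)}^{1/2}\Vert_p$ if and only if $X_0$ is a $W$-inverse of $A$.
   Context: $\mathcal{H}$ is a separable complex Hilbert space, $L(\mathcal{H})$ is the algebra of bounded linear operators on $\mathcal{H}$, $L(\mathcal{H})^{+}$ is the cone of positive semidefinite operators, $I$ is the identity operator, and $R(T)$ denotes the range of $T$. The operator order is: $S\le T$ if $T-S\in L(\mathcal{H})^{+}$. For $1\le p<\infty$, $S_p$ is the $p$-Schatten class: the compact $T\in L(\mathcal{H})$ with $\sum_k\lambda_k(T)^p<\infty$, where $\lambda_k(T)$ are the eigenvalues of $|T|=(T^*T)^{1/2}$ repeated according to multiplicity; its norm is $\Vert T\Vert_p=(\sum_k\lambda_k(T)^p)^{1/p}$. For $W\in L(\mathcal{H})^+$ with $W^{1/2}\in S_p$ and $X\in L(\mathcal{H})$, $\Vert X\Vert_{p,W}=\Vert W^{1/2}X\Vert_p$. For $W\in L(\mathcal{H})^{+}$ and a closed subspace $\mathcal{S}\subseteq\mathcal{H}$,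 the shorted operator of $W$ to $\mathcal{S}$ is $W_{/\mathcal{S}}=\max\{X\in L(\mathcal{H}): 0\le X\le W \text{ and } R(X)\subseteq \mathcal{S}^{\perp}\}$ (this maximum is known to exist); $W_{/\mathcal{S}}^{1/2}$ denotes its positive square root. The pair $(W,\mathcal{S})$ is compatible if there exists $Q\in L(\mathcal{H})$ with $Q^2=Q$, $R(Q)=\mathcal{S}$ and $WQ=Q^{*}W$. Let $\Vert x\Vert_W=\langle Wx,x\rangle^{1/2}$. An operator $X_0\in L(\mathcal{H})$ is a $W$-inverse of $A$ if $\Vert AX_0x-x\Vert_W\le\Vert Az-x\Vert_W$ for every $x,z\in\mathcal{H}$. *)

(* Defs.v *)
From HB Require Import structures.
From mathcomp Require Import all_boot all_order all_algebra.
From mathcomp Require Import sesquilinear complex.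
From mathcomp Require Import all_classical all_reals all_analysis.

Set Implicit Arguments.
Unset Strict Implicit.
Unset Printing Implicit Defensive.

Import Order.TTheory GRing.Theory Num.Theory Num.Def.
Import numFieldNormedType.Exports.

Local Open Scope classical_set_scope.
Local Open Scope ring_scope.
Local Open Scope complex_scope.

(* Used with K = R[i].  The norm `|x| takes its values in K, whose
   order is the partial one: 0 <= z means that z is real and nonnegative. *)
HB.mixin Record CompleteNormedModule_isHilbert (K : numClosedFieldType) H
    & CompleteNormedModule K H := {
  hdot : {dot H for (@conjC K)} ;
  hdot_norm : forall x : H, `|x| ^+ 2 = hdot x x
}.

#[short(type="hilbertType")]
HB.structure Definition Hilbert (K : numClosedFieldType) :=
  { H of CompleteNormedModule_isHilbert K H & CompleteNormedModule K H }.

Notation "''[' u , v ]" := (hdot u v) : ring_scope.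

Definition separable (T : topologicalType) : Prop :=
  exists D : set T, countable D /\ dense D.

Section Operators.
Variables (R : realType) (H : hilbertType R[i]).
Implicit Types (T X Y W : H -> H) (S : set H) (p : R).

(* The algebra L(H), as a set of maps. *)
Definition bounded_op : set (H -> H) :=
  [set T | linear T /\ exists M : R[i], forall x, `|T x| <= M * `|x|].

Definition psd_op : set (H -> H) :=
  [set T | bounded_op T /\ forall x, 0 <= '[T x, x]].

Definition op_le X Y : Prop := psd_op (Y \- X).

(* adjoint, sqrt_op and shorted pick the operator with the given property; it
   is unique, and the default value 0 is taken only if there is none (which
   does not happen for, respectively, T bounded, T positive semidefinite, and
   W positive semidefinite with S a closed subspace). *)
Definition adjoint T : H -> H :=
  xget (cst 0) [set T' | bounded_op T' /\ forall x y, '[T x, y] = '[x, T' y]].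

Definition sqrt_op T : H -> H :=
  xget (cst 0) [set T' | psd_op T' /\ T' \o T' = T].

Definition abs_op T : H -> H := sqrt_op (adjoint T \o T).

Definition orthocompl S : set H := [set x | forall y, S y -> '[x, y] = 0].

Definition shorted_candidates W S : set (H -> H) :=
  [set X | [/\ bounded_op X, op_le (cst 0) X, op_le X W &
               range X `<=` orthocompl S]].

Definition shorted W S : H -> H :=
  xget (cst 0) [set X | shorted_candidates W S X /\
                        forall Y, shorted_candidates W S Y -> op_le Y X].

Definition compact_op T : Prop :=
  compact (closure (T @` [set x | `|x| <= 1])).

Definition lin_indep n (v : 'I_n -> H) : Prop :=
  forall c : 'I_n -> R[i], \sum_(i < n) c i *: v i = 0 -> forall i, c i = 0.

Definition dimension S : \bar R :=
  ereal_sup [set n%:R%:E | n in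
    [set n | exists v : 'I_n -> H, lin_indep v /\ forall i, S (v i)]].

Definition eigspace T (l : R) : set H := [set x | T x = l%:C *: x].

(* The sum of the l_k(T)^p, grouped by value: each l > 0 is counted
   dim ker(|T| - l) times, and this is 0 when l is not an eigenvalue of |T|.
   The eigenvalue 0 does not contribute. *)
Definition schatten_sum p T : \bar R :=
  (\esum_(l in [set l : R | (0 < l)%R])
     dimension (eigspace (abs_op T) l) * (l `^ p)%:E)%E.

Definition schatten_class p : set (H -> H) :=
  [set T | [/\ bounded_op T, compact_op T & (schatten_sum p T < +oo)%E]].

(* Extended-real-valued: +oo outside S_p. *)
Definition schatten_norm p T : \bar R :=
  if `[< schatten_class p T >] then (schatten_sum p T `^ p^-1)%E else +oo%E.

Definition weighted_norm p W X : \bar R := schatten_norm p (sqrt_op W \o X).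

Definition compatible W S : Prop :=
  exists Q, [/\ bounded_op Q, Q \o Q = Q, range Q = S & W \o Q = adjoint Q \o W].

Definition W_seminorm W (x : H) : R[i] := sqrtC '[W x, x].

Definition W_inverse W A X0 : Prop :=
  bounded_op X0 /\
  forall x z, W_seminorm W (A (X0 x) - x) <= W_seminorm W (A z - x).

End Operators.

Definition is_minimum_on (R : realType) (U : Type) (D : set U)
    (f : U -> \bar R) (m : \bar R) : Prop :=
  (exists2 x, D x & f x = m) /\ forall x, D x -> (m <= f x)%E.

(* Main.v *)
Require Import Defs.
From mathcomp Require Import all_boot all_order all_algebra.
From mathcomp Require Import sesquilinear complex.
From mathcomp Require Import all_classical all_reals all_analysis.
From mathcomp Require Import ring lra.
Import Order.TTheory GRing.Theory Num.Theory.
Import numFieldNormedType.Exports.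
Local Open Scope classical_set_scope.
Local Open Scope ring_scope.
Local Open Scope complex_scope.
Set Implicit Arguments.
Unset Strict Implicit.
Unset Printing Implicit Defensive.

(** Write C for the square root of W and T X = C (A X - 1) for the weighted
    residual of X.

    The analytic core is a strict form of Weyl monotonicity (schatten_norm_le):
    if D and B satisfy nrm (D x) <= nrm (B x) for all x and B is in the Schatten
    class, then so is D, its norm is at most that of B, and equality of the norms
    forces nrm (D x) = nrm (B x) for all x. It is proved by choosing singular
    vectors greedily, each one maximizing nrm (B x) over the unit vectors orthogonal
    to the previous ones. The maxima exist because B is compact, the
    Courant-Fischer principle compares the k-th singular values of D and B, and if
    all of them agree, then a greedy sequence for D is greedy for B as well
    (greedy_transfer), which leaves no room between the two quadratic forms.

    X is a W-inverse of A exactly when the residual minimizes nrm (T X x) at each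
    x separately, that is, when T X x is orthogonal to the range of C A for each x
    (W_inverse_orthP). Therefore a W-inverse minimizes the Schatten norm.
    Conversely, if T X x is not orthogonal to some vector w of the range of C A,
    let E be the orthogonal projection along w. Then E (T X) is again a residual,
    with X changed by an operator of rank one; it is dominated by T X and strictly
    smaller at x, so its Schatten norm is strictly smaller. Hence the minimizers
    are the W-inverses (minimizer_W_inverse).

    It remains to see that W-inverses exist if and only if (W, range A) is
    compatible, and that the minimum has the given value. If Q is a W-selfadjoint
    projection on range A, then A X = Q has a bounded solution because the range is
    closed (right_factor), and this X is a W-inverse. If X is a W-inverse, then A X
    is such a projection up to the null space of W in range A, which is corrected
    by an orthogonal projection (W_inverse_compatible). Finally, for a W-inverse X
    the shorted operator is (T X)* (T X) (shortedE), so that its square root has the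
    Schatten norm of T X. *)

(** * The real inner product *)

Lemma ReZ (R : realType) (a : R) (z : R[i]) :
  complex.Re (a%:C * z) = a * complex.Re z.
Proof. by case: z => u v /=; rewrite mul0r subr0. Qed.

Lemma conj_ReZ (R : realType) (a : R) (z : R[i]) : (a%:C * z)^* = a%:C * z^*.
Proof.
by case: z => u v; apply/eqP; rewrite eq_complex /=; apply/andP; split; apply/eqP; ring.
Qed.

Lemma conj_real (R : realType) (a : R) : (a%:C)^* = a%:C.
Proof. by apply/eqP; rewrite eq_complex /= oppr0 !eqxx. Qed.

Lemma ge0_ReE (R : realType) (z : R[i]) : 0 <= z -> z = (complex.Re z)%:C.
Proof. by case: z => u v; rewrite lecE /= => /andP[/eqP-> _]. Qed.

Section RealInnerProduct.
Variables (R : realType) (H : hilbertType R[i]).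
Implicit Types (x y z : H) (a b t : R) (T : H -> H).
(** Minimality and positivity are statements about real quadratic polynomials,
    so most arguments use the real part of the inner product. A complex identity
    follows from its real part, applied to y and to 'i *: y: see hdotE. *)
Definition rdot x y : R := complex.Re '[x, y].
Definition nrm x : R := complex.Re `|x|.

Lemma norm_nrm x : `|x| = (nrm x)%:C.
Proof. exact: ge0_ReE. Qed.
Lemma nrm_ge0 x : 0 <= nrm x.
Proof. by have := normr_ge0 x; rewrite norm_nrm lecR. Qed.
Lemma hdotC x y : '[x, y] = ('[y, x])^*.
Proof. by rewrite hermC mul1r. Qed.
Lemma hdot0C x y : '[x, y] = 0 -> '[y, x] = 0.
Proof. by rewrite (hdotC y) => ->; exact: conjC0. Qed.
Lemma hdotZr (c : R[i]) x y : '[x, c *: y] = c^* * '[x, y].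
Proof. exact: linearZr_LR. Qed.
Lemma hdotZl (c : R[i]) x y : '[c *: x, y] = c * '[x, y].
Proof. exact: linearZl_LR. Qed.
Lemma hdotDl x y z : '[x + y, z] = '[x, z] + '[y, z].
Proof. exact: linearDl. Qed.
Lemma hdotBl x y z : '[x - y, z] = '[x, z] - '[y, z].
Proof. exact: linearBl. Qed.
Lemma hdotDr x y z : '[x, y + z] = '[x, y] + '[x, z].
Proof. exact: linearDr. Qed.
Lemma hdotBr x y z : '[x, y - z] = '[x, y] - '[x, z].
Proof. exact: linearBr. Qed.
Lemma hdot_suml (I : Type) (r : seq I) (P : pred I) (F : I -> H) y :
  '[\sum_(i <- r | P i) F i, y] = \sum_(i <- r | P i) '[F i, y].
Proof. exact: linear_sumlz. Qed.
Lemma hdot_sumr (I : Type) (r : seq I) (P : pred I) (F : I -> H) x :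
  '[x, \sum_(i <- r | P i) F i] = \sum_(i <- r | P i) '[x, F i].
Proof. exact: linear_sumr. Qed.
Lemma rdotC x y : rdot x y = rdot y x.
Proof. by rewrite /rdot hdotC; case: '[y, x]. Qed.
Lemma rdotDl x y z : rdot (x + y) z = rdot x z + rdot y z.
Proof. by rewrite /rdot linearDl raddfD. Qed.
Lemma rdotZl a x y : rdot (a%:C *: x) y = a * rdot x y.
Proof. by rewrite /rdot linearZl_LR; exact: ReZ. Qed.
Lemma rdotNl x y : rdot (- x) y = - rdot x y.
Proof. by rewrite /rdot linearNl raddfN. Qed.
Lemma rdotBl x y z : rdot (x - y) z = rdot x z - rdot y z.
Proof. by rewrite rdotDl rdotNl. Qed.
Lemma rdotDr x y z : rdot x (y + z) = rdot x y + rdot x z.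
Proof. by rewrite rdotC rdotDl 2!(rdotC x). Qed.
Lemma rdotZr a x y : rdot x (a%:C *: y) = a * rdot x y.
Proof. by rewrite rdotC rdotZl rdotC. Qed.
Lemma rdotNr x y : rdot x (- y) = - rdot x y.
Proof. by rewrite rdotC rdotNl rdotC. Qed.
Lemma rdotBr x y z : rdot x (y - z) = rdot x y - rdot x z.
Proof. by rewrite rdotDr rdotNr. Qed.
Lemma rdot0l x : rdot 0 x = 0.
Proof. by rewrite /rdot linear0l. Qed.
Lemma rdot0r x : rdot x 0 = 0.
Proof. by rewrite rdotC rdot0l. Qed.
Lemma nrm2 x : nrm x ^+ 2 = rdot x x.
Proof. by rewrite /rdot -hdot_norm norm_nrm -rmorphXn. Qed.
Lemma hdot_self x : '[x, x] = (nrm x ^+ 2)%:C.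
Proof. by rewrite -hdot_norm norm_nrm -rmorphXn. Qed.
Lemma Im_conji (z : R[i]) : z = complex.Re z +i* complex.Re (('i : R[i])^* * z).
Proof. by case: z => u v; simpc. Qed.
Lemma hdotE x y : '[x, y] = rdot x y +i* rdot x ('i *: y).
Proof. by rewrite /rdot linearZr_LR; exact: Im_conji. Qed.
Lemma rdot_hdot0 x y : '[x, y] = 0 -> rdot x y = 0.
Proof. by rewrite /rdot => ->. Qed.

Lemma hdot_eqP x y x' y' :
  rdot x y = rdot x' y' -> rdot x ('i *: y) = rdot x' ('i *: y') ->
  '[x, y] = '[x', y'].
Proof. by rewrite !hdotE => -> ->. Qed.

Lemma nrm0 : nrm 0 = 0. Proof. by rewrite /nrm normr0. Qed.
Lemma nrmN x : nrm (- x) = nrm x. Proof. by rewrite /nrm normrN. Qed.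
Lemma nrmB x y : nrm (x - y) = nrm (y - x). Proof. by rewrite -nrmN opprB. Qed.
Lemma nrmZC (c : R[i]) x : nrm (c *: x) = complex.Re `|c| * nrm x.
Proof.
apply: (@complexI R); rewrite rmorphM -!norm_nrm normrZ; congr (_ * _).
exact: ge0_ReE.
Qed.
Lemma nrmZ a x : nrm (a%:C *: x) = `|a| * nrm x.
Proof. by rewrite nrmZC normc_def /= expr0n addr0 sqrtr_sqr. Qed.
Lemma ler_nrmD x y : nrm (x + y) <= nrm x + nrm y.
Proof. by have := ler_normD x y; rewrite !norm_nrm -rmorphD lecR. Qed.
Lemma ler_nrmB x y : nrm (x - y) <= nrm x + nrm y.
Proof. by rewrite (le_trans (ler_nrmD _ _))// nrmN. Qed.
Lemma ler_nrm_dist x y : nrm x <= nrm y + nrm (x - y).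
Proof. by rewrite -{1}(subrK y x) addrC ler_nrmD. Qed.
Lemma nrm_eq0 x : (nrm x == 0) = (x == 0).
Proof. by rewrite -(normr_eq0 x) norm_nrm; apply/eqP/eqP => [->|[]]. Qed.
Lemma nrm_gt0 x : (0 < nrm x) = (x != 0).
Proof. by rewrite lt_def nrm_ge0 andbT nrm_eq0. Qed.
Lemma nrmD2 x y : nrm (x + y) ^+ 2 = nrm x ^+ 2 + 2 * rdot x y + nrm y ^+ 2.
Proof. by rewrite !nrm2 !rdotDl !rdotDr (rdotC y x); ring. Qed.
Lemma nrmB2 x y : nrm (x - y) ^+ 2 = nrm x ^+ 2 - 2 * rdot x y + nrm y ^+ 2.
Proof. by rewrite nrmD2 nrmN rdotNr; ring. Qed.
Lemma parallelogram x y :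
  nrm (x + y) ^+ 2 + nrm (x - y) ^+ 2 = 2 * nrm x ^+ 2 + 2 * nrm y ^+ 2.
Proof. by rewrite nrmD2 nrmB2; ring. Qed.

(** The first-order condition at a minimum: for t small and of the sign
    opposite to b, the linear term dominates. *)
Lemma quad_ge0_lin0 (b c : R) :
  (forall t : R, 0 <= 2 * t * b + t ^+ 2 * c) -> b = 0.
Proof.
move=> h; have [//|b0] := eqVneq b 0.
have b2 : 0 < b ^+ 2 by rewrite exprn_even_gt0.
have [c0|c0] := lerP c 0; first by have := h (- b); nra.
have := h (- b / c).
have -> : 2 * (- b / c) * b + (- b / c) ^+ 2 * c = - (b ^+ 2 / c) by field; rewrite gt_eqF.
by have := divr_gt0 b2 c0; lra.
Qed.

Lemma rdot_CS x y : `|rdot x y| <= nrm x * nrm y.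
Proof.
have h u v : rdot u v <= nrm u * nrm v.
  have [->|u0] := eqVneq u 0; first by rewrite rdot0l nrm0 mul0r.
  have [->|v0] := eqVneq v 0; first by rewrite rdot0r nrm0 mulr0.
  rewrite -nrm_gt0 in u0; rewrite -nrm_gt0 in v0.
  have := sqr_ge0 (nrm ((nrm v)%:C *: u - (nrm u)%:C *: v)).
  rewrite nrmB2 !nrmZ rdotZl rdotZr !ger0_norm ?nrm_ge0// => h.
  have : 0 <= (nrm u * nrm v) * (nrm u * nrm v - rdot u v) by nra.
  by rewrite pmulr_rge0 ?mulr_gt0// subr_ge0.
by rewrite ler_norml h andbT lerNl -rdotNl -[nrm x]nrmN h.
Qed.
Lemma rdot_le x y : rdot x y <= nrm x * nrm y.
Proof. exact: le_trans (ler_norm _) (rdot_CS x y). Qed.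

Lemma nrm_CS_hdot x y : complex.Re `|'[x, y]| <= nrm x * nrm y.
Proof.
(* Rotate x so that the inner product becomes real. *)
have [->|n0] := eqVneq '[x, y] 0.
  by rewrite normr0 /= mulr_ge0 ?nrm_ge0.
pose c := `|'[x, y]| / '[x, y].
have c1 : `|c| = 1 by rewrite normf_div normr_id divff// normr_eq0.
have -> : `|'[x, y]| = '[c *: x, y] by rewrite linearZl_LR /= /c divfK.
have := rdot_le (c *: x) y; rewrite nrmZC c1 mul1r; exact.
Qed.

Lemma orth_realP (V : H -> Prop) x :
  (forall (c : R[i]) y, V y -> V (c *: y)) ->
  (forall y, V y -> rdot x y = 0) -> forall y, V y -> '[x, y] = 0.
Proof. by move=> VZ h y Vy; rewrite hdotE !h//; exact: VZ. Qed.

Lemma nrm_sum_orth (n : nat) (v : 'I_n -> H) (P : pred 'I_n) :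
  (forall i j, i != j -> rdot (v i) (v j) = 0) ->
  nrm (\sum_(i | P i) v i) ^+ 2 = \sum_(i | P i) nrm (v i) ^+ 2.
Proof.
move=> o; rewrite nrm2 /rdot hdot_suml raddf_sum; apply: eq_bigr => i Pi.
rewrite nrm2 hdot_sumr raddf_sum (bigD1 i)//= big1 ?addr0// => j /andP[_ ji].
by apply: o; rewrite eq_sym.
Qed.
End RealInnerProduct.

(** * Completeness, projections, adjoints and uniform boundedness *)

Section Completeness.
Variables (R : realType) (H : hilbertType R[i]).
Implicit Types (x y z : H) (a b t : R) (T : H -> H).

Lemma ball_nrm x (e : R) y : ball x e%:C y <-> nrm (x - y) < e.
Proof. by rewrite -ball_normE /= norm_nrm ltcR. Qed.

Lemma gt0_ReE (c : R[i]) : 0 < c -> 0 < complex.Re c /\ c = (complex.Re c)%:C.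
Proof. by case: c => a b; rewrite ltcE /= => /andP[/eqP-> ->]. Qed.

Lemma nbhs_nrmP x (A : set H) :
  nbhs x A <-> exists2 e : R, 0 < e & forall y, nrm (x - y) < e -> A y.
Proof.
split=> [/nbhs_ballP[c /= c0 cA]|[e e0 eA]].
  have [e0 cE] := gt0_ReE c0; exists (complex.Re c) => // y /ball_nrm.
  by rewrite -cE; exact: cA.
by apply/nbhs_ballP; exists e%:C => /=; [rewrite ltcR|move=> y /ball_nrm; exact: eA].
Qed.

Lemma closure_nrmP (A : set H) x :
  closure A x <-> forall e : R, 0 < e -> exists2 y, A y & nrm (x - y) < e.
Proof.
split=> [cl e e0|h B /nbhs_nrmP[e e0 eB]].
  have [|y [Ay xy]] := cl [set y | nrm (x - y) < e]; last by exists y.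
  by apply/nbhs_nrmP; exists e.
by have [y Ay xy] := h e e0; exists y; split=> //; exact: eB.
Qed.

(** All extremal problems below are solved in this way: F e is the set of
    solutions up to an error e, and a parallelogram argument bounds its diameter. *)
Lemma complete_family (F : R -> set H) :
  (forall e, 0 < e -> F e !=set0) ->
  (forall e e', e <= e' -> F e `<=` F e') ->
  (forall d, 0 < d -> exists2 e, 0 < e &
     forall x y, F e x -> F e y -> nrm (x - y) < d) ->
  exists x, forall e, 0 < e -> closure (F e) x.
Proof.
move=> F0 Fmono Fsmall.
have FF : ProperFilter (filter_from [set e : R | 0 < e] F).
  apply: filter_from_proper => //; apply: filter_from_filter; first by exists 1 => /=.
  move=> e e' /= e0 e'0; exists (Num.min e e'); first by rewrite /= lt_min e0.
  by move=> x Fx; split; apply: Fmono Fx; rewrite ge_min lexx ?orbT.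
have /cauchy_cvg cF : cauchy (filter_from [set e : R | 0 < e] F).
  apply: cauchy_exP => c c0; have [d0 ->] := gt0_ReE c0.
  have [e e0 small] := Fsmall _ d0; have [x Fx] := F0 _ e0.
  by exists x, e => // y Fy; apply/ball_nrm; exact: small.
exists (lim (filter_from [set e : R | 0 < e] F)) => e e0 B nB.
have [e' e'0 e'B] := cF _ nB.
have m0 : 0 < Num.min e e' by rewrite lt_min e0.
have [y Fy] := F0 _ m0; exists y; split; first by apply: Fmono Fy; rewrite ge_min lexx.
by apply: e'B; apply: Fmono Fy; rewrite ge_min lexx orbT.
Qed.

(** The steps of u are bounded by the decrements of d, which telescope; hence
    d n bounds the distance from u n to all later terms and to the limit. *)
Lemma dominated_limit (u : nat -> H) (d : nat -> R) :
  (forall n, nrm (u n.+1 - u n) <= d n - d n.+1) -> (forall n, 0 <= d n) ->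
  (forall e, 0 < e -> exists n, d n < e) ->
  exists x, forall n, nrm (x - u n) <= d n.
Proof.
move=> step d0 dinf.
have mono n k : nrm (u (n + k)%N - u n) <= d n - d (n + k)%N.
  elim: k => [|k IH]; first by rewrite addn0 !subrr nrm0.
  rewrite addnS; have := ler_nrmD (u (n + k).+1 - u (n + k)%N) (u (n + k)%N - u n).
  by rewrite subrKA; have := step (n + k)%N; lra.
have dmono n k : d (n + k)%N <= d n.
  by have := mono n k; have := nrm_ge0 (u (n + k)%N - u n); lra.
have dist m n : nrm (u m - u n) <= Num.max (d m) (d n).
  rewrite le_max; have [mn|nm] := leqP m n.
    rewrite nrmB -(subnKC mn); have := mono m (n - m)%N.
    by have := d0 (m + (n - m))%N; move=> ? ?; apply/orP; left; lra.
  rewrite -(subnKC (ltnW nm)); have := mono n (m - n)%N.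
  by have := d0 (n + (m - n))%N; move=> ? ?; apply/orP; right; lra.
have [e e0|e e' ee' x [n dn <-]|e e0|x xP] :=
    @complete_family (fun e => [set u n | n in [set n | d n < e]]).
- by have [n dn] := dinf e e0; exists (u n), n.
- by exists n => //; exact: lt_le_trans ee'.
- exists e => // x y [m dm <-] [n dn <-]; apply: le_lt_trans (dist m n) _.
  by rewrite gt_max dm dn.
exists x => n; apply/ler_addgt0Pr => e e0.
have e20 : 0 < e / 2 by rewrite divr_gt0.
have /closure_nrmP/(_ _ e20)[_ [m /= dm <-] xm] := xP (e / 2) e20.
have := ler_nrmD (x - u m) (u m - u n); rewrite subrKA.
have := dist m n; have : Num.max (d m) (d n) <= e / 2 + d n.
  by rewrite ge_max; have := d0 n; have := d0 m; move=> ? ?; apply/andP; split; lra.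
by lra.
Qed.

Definition is_subspace (V : set H) :=
  V 0 /\ forall (c : R[i]) x y, V x -> V y -> V (c *: x + y).

Lemma subspaceZ V (c : R[i]) x : is_subspace V -> V x -> V (c *: x).
Proof. by case=> V0 VL Vx; rewrite -[_ *: _]addr0; exact: VL. Qed.
Lemma subspaceD V x y : is_subspace V -> V x -> V y -> V (x + y).
Proof. by case=> V0 VL Vx Vy; rewrite -[x]scale1r; exact: VL. Qed.
Lemma subspaceB V x y : is_subspace V -> V x -> V y -> V (x - y).
Proof. by case=> V0 VL Vx Vy; rewrite addrC -scaleN1r; exact: VL. Qed.

(** By the parallelogram law the almost closest points of V form a Cauchy
    family; orthogonality is the first-order condition at their limit. *)
Lemma projection V x : is_subspace V -> closed V ->
  exists2 v, V v & forall w, V w -> '[x - v, w] = 0.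
Proof.
move=> sV cV; have V0 := sV.1.
pose E := [set nrm (x - v) ^+ 2 | v in V].
have Einf : has_inf E.
  by split; [exists (nrm (x - 0) ^+ 2), 0|exists 0 => _ [v _ <-]; exact: sqr_ge0].
have infE v : V v -> inf E <= nrm (x - v) ^+ 2.
  by move=> Vv; apply: ge_inf; [exact: Einf.2|exists v].
have half v w : V v -> V w -> nrm (v - w) ^+ 2 =
    2 * nrm (x - v) ^+ 2 + 2 * nrm (x - w) ^+ 2 - 4 * nrm (x - 2^-1%:C *: (v + w)) ^+ 2.
  move=> Vv Vw.
  have := parallelogram (x - v) (x - w).
  have -> : x - v - (x - w) = w - v by rewrite opprB addrC subrKA.
  have -> : x - v + (x - w) = 2%:C *: (x - 2^-1%:C *: (v + w)).
    rewrite scalerBr scalerA -rmorphM divff// scale1r.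
    by rewrite rmorphD scalerDl scale1r addrACA opprD.
  by rewrite nrmZ ger0_norm// exprMn nrmB => h; lra.
have [e e0|e e' ee' v [Vv ve]|d d0|v vP] :=
   @complete_family (fun e => [set v | V v /\ nrm (x - v) ^+ 2 < inf E + e]).
- have [_ [v Vv <-] ve] := inf_adherent e0 Einf.
  by exists v; split.
- by split=> //; apply: lt_le_trans ve _; rewrite lerD2l.
- have d40 : 0 < d ^+ 2 / 4 by rewrite divr_gt0// exprn_gt0.
  exists (d ^+ 2 / 4) => // v w [Vv ve] [Vw we].
  rewrite -(@ltr_pXn2r _ 2)// ?nnegrE ?nrm_ge0 ?(ltW d0)// half//.
  have := infE _ (subspaceZ 2^-1%:C sV (subspaceD sV Vv Vw)); lra.
have Vv : V v.
  apply: cV; apply/closure_nrmP => e e0.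
  have /closure_nrmP/(_ _ e0)[w [Vw _] vw] := vP 1 ltr01.
  by exists w.
have vmin : nrm (x - v) ^+ 2 <= inf E.
  suff h : nrm (x - v) <= Num.sqrt (inf E).
    rewrite -(@sqr_sqrtr _ (inf E)) ?ler_pXn2r// ?nnegrE ?nrm_ge0 ?sqrtr_ge0//.
    by apply: lb_le_inf; [exact: Einf.1|move=> _ [w _ <-]; exact: sqr_ge0].
  apply/ler_addgt0Pr => e e0; have e20 : 0 < e / 2 by rewrite divr_gt0.
  have e40 : 0 < (e / 2) ^+ 2 by rewrite exprn_gt0.
  have /closure_nrmP/(_ _ e20)[w [Vw we] vw] := vP _ e40.
  have inf0 : 0 <= inf E.
    by apply: lb_le_inf; [exact: Einf.1|move=> _ [y _ <-]; exact: sqr_ge0].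
  have s2 := sqr_sqrtr inf0; have s0 := sqrtr_ge0 (inf E).
  have wE : nrm (x - w) <= Num.sqrt (inf E) + e / 2.
    rewrite -(@ler_pXn2r _ 2)// ?nnegrE ?nrm_ge0 ?addr_ge0// ?(ltW e20)//.
    by rewrite sqrrD s2; have := mulr_ge0 s0 (ltW e20); lra.
  have := ler_nrmD (x - w) (w - v); rewrite subrKA nrmB in vw *; lra.
exists v => //; apply: orth_realP => [c y|w Vw]; first exact: subspaceZ.
apply: oppr_inj; rewrite oppr0; apply: (@quad_ge0_lin0 _ _ (nrm w ^+ 2)) => t.
have := infE _ (subspaceD sV Vv (subspaceZ t%:C sV Vw)).
rewrite opprD addrA nrmB2 nrmZ exprMn real_normK ?num_real// rdotZr.
by move=> h; lra.
Qed.

(** The representing vector spans the orthogonal complement of the kernel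
    of f. *)
Lemma riesz (f : H -> R[i]) (M : R) :
  (forall (c : R[i]) x y, f (c *: x + y) = c * f x + f y) ->
  (forall x, complex.Re `|f x| <= M * nrm x) ->
  exists y, forall x, f x = '[x, y].
Proof.
move=> fL fM.
have f0 : f 0 = 0.
  by apply: (addrI (f 0)); rewrite addr0 -{3}[0]addr0 -{3}[0](scale1r) fL mul1r.
have [[x0 fx0]|f_eq0] := pselect (exists x, f x != 0); last first.
  exists 0 => x; rewrite linear0r; apply/eqP/negPn/negP => fx.
  by apply: f_eq0; exists x.
pose V : set H := [set x | f x = 0].
have sV : is_subspace V.
  by split=> // c x y Vx Vy; rewrite /V /= fL Vx Vy mulr0 addr0.
have fB x y : f (x - y) = f x - f y.
  by rewrite -scaleN1r addrC fL mulN1r addrC.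
have cV : closed V.
  move=> x /closure_nrmP cx; apply/eqP; rewrite -normr_eq0 (ge0_ReE (normr_ge0 (f x))).
  apply/eqP; congr (_%:C); apply/le_anti/andP; split; last first.
    by have := normr_ge0 (f x); rewrite lecE => /andP[].
  apply/ler_addgt0Pr => e e0; rewrite add0r.
  have M1 : 0 < `|M| + 1 by rewrite ltr_wpDl.
  have [y Vy xy] := cx (e / (`|M| + 1)) (divr_gt0 e0 M1).
  have := fM (x - y); rewrite fB Vy subr0 => /le_trans; apply.
  rewrite ltr_pdivlMr// in xy; have := ler_norm M; have := nrm_ge0 (x - y); nra.
have [v Vv ov] := projection x0 sV cV.
have fu : f (x0 - v) != 0 by rewrite fB Vv subr0.
set u := x0 - v in ov fu; have u0 : '[u, u] != 0.
  by rewrite dnorm_eq0; apply: contraNneq fu => ->; rewrite f0.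
exists ((f u / '[u, u])^* *: u) => x.
have : '[x - (f x / f u) *: u, u] = 0.
  rewrite hdotC ov ?rmorph0// /V /= fB -[_ *: u]addr0 fL f0 addr0 divfK// subrr//.
rewrite hdotBl hdotZl => /eqP; rewrite subr_eq0 => /eqP xu.
by rewrite hdotZr conjCK xu mulrCA divfK// divfK.
Qed.

Lemma bounded_nrmP T : bounded_op T <->
  linear T /\ exists2 M : R, 0 <= M & forall x, nrm (T x) <= M * nrm x.
Proof.
split=> -[lT].
  move=> [M TM]; split=> //; exists `|complex.Re M| => // x.
  have := TM x; rewrite !norm_nrm lecE => /andP[_] /=.
  have -> : complex.Re (M * (nrm x)%:C) = complex.Re M * nrm x by rewrite mulrC ReZ mulrC.
  move=> h; apply: le_trans h _.
  by rewrite ler_wpM2r ?nrm_ge0 ?ler_norm.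
move=> [M M0 TM]; split=> //; exists M%:C => x.
by rewrite !norm_nrm -rmorphM lecR.
Qed.

Lemma linD T x y : linear T -> T (x + y) = T x + T y.
Proof. by move=> l; rewrite -{1}[x]scale1r l scale1r. Qed.
Lemma lin0 T : linear T -> T 0 = 0.
Proof. by move=> l; apply: (addrI (T 0)); rewrite -linD// !addr0. Qed.
Lemma linZ T (c : R[i]) x : linear T -> T (c *: x) = c *: T x.
Proof. by move=> l; rewrite -[_ *: x]addr0 l lin0// addr0. Qed.
Lemma linN T x : linear T -> T (- x) = - T x.
Proof. by move=> l; rewrite -scaleN1r linZ// scaleN1r. Qed.
Lemma linB T x y : linear T -> T (x - y) = T x - T y.
Proof. by move=> l; rewrite linD// linN. Qed.
Lemma lin_sum T (I : Type) (r : seq I) (P : pred I) (c : I -> R[i]) (v : I -> H) :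
  linear T -> T (\sum_(i <- r | P i) c i *: v i) = \sum_(i <- r | P i) c i *: T (v i).
Proof.
move=> l; elim/big_rec2: _ => [|i u w _ <-]; first exact: lin0.
by rewrite l.
Qed.

Lemma hdot_ext y z : (forall x, '[x, y] = '[x, z]) -> y = z.
Proof.
move=> h; apply/eqP; rewrite -subr_eq0 -(dnorm_eq0 hdot); apply/eqP.
by rewrite hdotBr h subrr.
Qed.

Lemma adjointP T : bounded_op T ->
  bounded_op (adjoint T) /\ forall x y, '[T x, y] = '[x, adjoint T y].
Proof.
move=> bT; suff : exists T', bounded_op T' /\ forall x y, '[T x, y] = '[x, T' y].
  by move=> h; exact: (xgetPex (cst 0) h).
have /bounded_nrmP[lT [M M0 TM]] := bT.
have ex y : exists z, forall x, '[T x, y] = '[x, z].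
  apply: (@riesz (fun x => '[T x, y]) (M * nrm y)) => [c x z|x].
    by rewrite lT linearDl linearZl_LR.
  apply: le_trans (nrm_CS_hdot _ _) _.
  by rewrite mulrAC ler_wpM2r ?nrm_ge0.
have [T' T'P] := choice ex; exists T'; split=> //; apply/bounded_nrmP; split.
  move=> c x y; apply: hdot_ext => z.
  by rewrite -T'P !hdotDr !hdotZr -!T'P.
exists M => // y; have [->|T'y] := eqVneq (nrm (T' y)) 0.
  by rewrite mulr_ge0 ?nrm_ge0.
have T'y0 : 0 < nrm (T' y) by rewrite lt_def T'y nrm_ge0.
rewrite -(ler_pM2l T'y0) -expr2 nrm2 {1}/rdot -T'P.
apply: le_trans (rdot_le (T (T' y)) y) _.
by have := ler_wpM2r (nrm_ge0 y) (TM (T' y)); lra.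
Qed.

(** A gliding hump. If the norms in S were unbounded, choose s n in S of norm
    at least 4 * 4 ^ n and add up humps of norm 3 ^ - n in the directions s n.
    The tail after the n-th hump has at most half the norm of that hump, so the sum
    has an inner product of order (4 / 3) ^ n with s n. *)
Lemma uniform_boundedness (S : set H) :
  (forall y, exists M : R, forall s, S s -> `|rdot y s| <= M) ->
  exists M : R, forall s, S s -> nrm s <= M.
Proof.
move=> pb; apply: contrapT => nub.
have big (M : R) : exists s, S s /\ M < nrm s.
  apply: contrapT => h; apply: nub; exists M => s Ss.
  by rewrite leNgt; apply/negP => Ms; apply: h; exists s.
have [s sP] := choice (fun n : nat => big (4 ^+ n * 4 + 1)).
have sgt n : 0 < nrm (s n).
  by apply: le_lt_trans (sP n).2; rewrite addr_ge0// mulr_ge0// exprn_ge0.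
pose d n : R := 3^-1 ^+ n.
have d0 n : 0 < d n by rewrite exprn_gt0// invr_gt0.
have dS n : d n.+1 = d n / 3 by rewrite /d exprSr.
pose h n : H := (d n / nrm (s n))%:C *: s n.
have hn n : nrm (h n) = d n.
  by rewrite nrmZ ger0_norm ?divfK ?gt_eqF// divr_ge0// ltW.
have hs n : rdot (h n) (s n) = d n * nrm (s n).
  by rewrite rdotZl -nrm2 expr2 mulrA divfK// gt_eqF.
(* The sign of the n-th hump is chosen so that it does not cancel against the
   previous ones. *)
have pick_sign n x : exists x', nrm (x' - x) = d n /\ d n * nrm (s n) <= `|rdot x' (s n)|.
  have [p|p] := lerP 0 (rdot x (s n)).
    exists (x + h n); rewrite addrAC subrr add0r hn rdotDl hs; split=> //.
    by apply: le_trans (ler_norm _); rewrite lerDr.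
  exists (x - h n); rewrite addrAC subrr add0r nrmN hn rdotBl hs; split=> //.
  by rewrite distrC; apply: le_trans (ler_norm _); lra.
have [g gP] := choice (fun nx : nat * H => pick_sign nx.1 nx.2).
pose u := fix u n := if n is m.+1 then g (m, u m) else 0.
have [n|n|e e0|x xP] := @dominated_limit u (fun n => d n * (3 / 2)).
- by rewrite (gP (n, u n)).1 /= dS; have := d0 n; lra.
- by have := d0 n; lra.
- have e20 : 0 < e / 2 by rewrite divr_gt0.
  have : `|3^-1 : R| < 1 by rewrite ger0_norm// invf_lt1// ltr1n.
  move=> /cvg_expr/cvgrPdist_lt/(_ _ e20)[N _ /(_ N (leqnn N))] /=.
  rewrite sub0r normrN ger0_norm ?exprn_ge0// => h'; exists N.
  by rewrite /d; lra.
have [M MP] := pb x.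
have low n : (4 / 3) ^+ n <= M.
  apply: le_trans (MP (s n) (sP n).1).
  have h1 : d n * nrm (s n) <= `|rdot (u n.+1) (s n)| := (gP (n, u n)).2.
  have := rdot_CS (x - u n.+1) (s n); rewrite rdotBl.
  have := ler_wpM2r (nrm_ge0 (s n)) (xP n.+1); rewrite dS => h2 h3.
  have h4 := ler_normB (rdot x (s n) - rdot (u n.+1) (s n)) (rdot x (s n)).
  rewrite [X in `|X|]addrAC subrr add0r normrN in h4.
  have E : (4 / 3 : R) ^+ n = d n * 4 ^+ n by rewrite expr_div_n mulrC /d exprVn.
  have := ler_wpM2l (ltW (d0 n)) (ltW (sP n).2).
  rewrite E mulrDr mulr1 mulrA => h5.
  have h6 := d0 n; have : 0 <= d n * 4 ^+ n by rewrite mulr_ge0 ?exprn_ge0// ltW.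
  lra.
have M0 : 0 < M + 1 by have := low 0%N; rewrite expr0; lra.
have : `|3 / 4 : R| < 1 by rewrite ger0_norm//; lra.
move=> /cvg_expr/cvgrPdist_lt/(_ (M + 1)^-1).
rewrite invr_gt0 => /(_ M0)[N _ /(_ N (leqnn N))] /=.
rewrite sub0r normrN ger0_norm ?exprn_ge0// -[3 / 4]invf_div exprVn.
rewrite ltf_pV2 ?posrE ?exprn_gt0//.
by have := low N; lra.
Qed.
End Completeness.

(** * Singular vectors of a compact operator *)

Section GreedyDiagonalization.
Variables (R : realType) (H : hilbertType R[i]).
Implicit Types (x y z : H) (a b t : R) (B D T : H -> H) (e f : nat -> H).

Lemma compact_op_cluster B (u : nat -> H) : compact_op B ->
  (forall n, nrm (u n) <= 1) ->
  exists y, forall d N, 0 < d -> exists2 n, (N <= n)%N & nrm (y - B (u n)) < d.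
Proof.
move=> cB u1.
have [|y [_ yP]] := cB ((B \o u) @ \oo) _.
  exists 0%N => // n _; apply: subset_closure; exists (u n) => //=.
  by rewrite norm_nrm -(rmorph1 (real_complex R)) lecR.
exists y => d N d0.
have nb : nbhs y [set z | nrm (y - z) < d] by apply/nbhs_nrmP; exists d.
have [|_ [[n Nn <-] yz]] := yP ((B \o u) @` [set n | (N <= n)%N]) _ _ nb.
  by exists N => // n Nn; exists n.
by exists n.
Qed.

(** Stated for an operator D dominated by B, in order to transfer compactness
    from B to D. *)
Lemma compact_op_separated B D : compact_op B -> linear B -> linear D ->
  (forall x, nrm (D x) <= nrm (B x)) -> forall (u : nat -> H) d, 0 < d ->
  (forall n, nrm (u n) <= 1) ->
  exists i j, (i < j)%N /\ nrm (D (u j) - D (u i)) < d.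
Proof.
move=> cB lB lD DB u d d0 u1.
have [y yP] := compact_op_cluster cB u1.
have d20 : 0 < d / 2 by rewrite divr_gt0.
have [m _ ym] := yP _ 0%N d20; have [n mn yn] := yP _ m.+1 d20.
exists m, n; split=> //; rewrite -linB//; apply: le_lt_trans (DB _) _.
rewrite linB//; have := ler_nrmB (y - B (u m)) (y - B (u n)).
have -> : y - B (u m) - (y - B (u n)) = B (u n) - B (u m).
  by rewrite opprB addrC addrA subrK.
by lra.
Qed.

Lemma closed_orth (S : set H) : closed [set x | forall y, S y -> '[x, y] = 0].
Proof.
move=> x /closure_nrmP cx y Sy.
apply/eqP; rewrite -normr_eq0 (ge0_ReE (normr_ge0 _)); apply/eqP; congr (_%:C).
apply/le_anti/andP; split; last by have := normr_ge0 '[x, y]; rewrite lecE => /andP[].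
apply/ler_addgt0Pr => e e0; rewrite add0r.
have y1 : 0 < nrm y + 1 by rewrite ltr_wpDl ?nrm_ge0.
have [z zS xz] := cx (e / (nrm y + 1)) (divr_gt0 e0 y1).
have -> : '[x, y] = '[x - z, y] by rewrite hdotBl zS// subr0.
apply: le_trans (nrm_CS_hdot _ _) _.
by move: xz; rewrite ltr_pdivlMr//; have := nrm_ge0 (x - z); nra.
Qed.

Lemma subspace_orth (S : set H) : is_subspace [set x | forall y, S y -> '[x, y] = 0].
Proof.
split=> [y _|c x y hx hy z Sz]; first by rewrite linear0l.
by rewrite hdotDl hdotZl hx// hy// mulr0 addr0.
Qed.

(** Consider almost maximizing vectors x, x' of the unit ball of V whose images
    are close to one point y. Then B (x + x') is almost as long as 2 y, hence
    x + x' is almost as long as 2, and the parallelogram law makes x - x' small: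
    such vectors form a Cauchy family. *)
Lemma compact_op_max B (V : set H) : bounded_op B -> compact_op B ->
  is_subspace V -> closed V ->
  exists e : H, [/\ V e, nrm e <= 1 & forall x, V x -> nrm (B x) <= nrm (B e) * nrm x].
Proof.
move=> /bounded_nrmP[lB [M M0 BM]] cB sV cV; have V0 := sV.1.
pose E := [set nrm (B x) | x in [set x | V x /\ nrm x <= 1]].
have Esup : has_sup E.
  split; first by exists (nrm (B 0)), 0 => //; rewrite /= nrm0 ler01.
  exists M => _ [x [_ x1] <-]; apply: le_trans (BM x) _.
  by rewrite -[leRHS]mulr1 ler_wpM2l.
set s := sup E.
have Es x : V x -> nrm x <= 1 -> nrm (B x) <= s.
  by move=> Vx x1; apply: ub_le_sup; [exact: Esup.2|exists x].
have s0 : 0 <= s by have := Es 0 V0; rewrite nrm0 lin0// nrm0; apply.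
have Vs x : V x -> nrm (B x) <= s * nrm x.
  move=> Vx; have [->|x0] := eqVneq x 0; first by rewrite lin0// nrm0 mulr0.
  rewrite -nrm_gt0 in x0.
  have := Es _ (subspaceZ (nrm x)^-1%:C sV Vx).
  rewrite linZ// !nrmZ ger0_norm ?invr_ge0 ?nrm_ge0// mulVf ?gt_eqF//.
  by move=> /(_ (lexx _)); rewrite mulrC ler_pdivrMr.
have [s_0|s_neq0] := eqVneq s 0.
  exists 0; split=> //; first by rewrite nrm0 ler01.
  by move=> x Vx; rewrite lin0// nrm0 mul0r -(mul0r (nrm x)) -{1}s_0 Vs.
have {s_neq0}s_gt0 : 0 < s by rewrite lt_def s_neq0.
have approx n : exists x, [/\ V x, nrm x <= 1 & s - n.+1%:R^-1 < nrm (B x)].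
  have n0 : 0 < n.+1%:R^-1 :> R by rewrite invr_gt0.
  by have [_ [x [Vx x1] <-] h] := sup_adherent n0 Esup; exists x.
have [u uP] := choice approx.
have [y yP] := compact_op_cluster cB (fun n => let: And3 _ h _ := uP n in h).
have [d d0|d d' dd' x [Vx [x1 [xy xs]]]|d d0|x xP] := @complete_family _ H
   (fun d => [set x | V x /\ nrm x <= 1 /\ nrm (y - B x) < d /\ s - d < nrm (B x)]).
- have [N Nd] : exists N, N.+1%:R^-1 < d.
    have := near_infty_natSinv_lt (PosNum d0) => -[N _ /(_ N (leqnn N))].
    by exists N.
  have [n Nn ny] := yP d N d0; exists (u n).
  have [Vu u1 su] := uP n; split=> //; split=> //; split=> //.
  apply: le_lt_trans su; rewrite lerD2l lerN2 (le_trans _ (ltW Nd))//.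
  by rewrite lef_pV2 ?posrE// ler_nat.
- by split=> //; split=> //; split; lra.
- pose c := Num.min (s / 2) (s * d ^+ 2 / 32).
  have d20 : 0 < s * d ^+ 2 / 32 by rewrite divr_gt0// mulr_gt0// exprn_gt0.
  have c0 : 0 < c by rewrite lt_min divr_gt0.
  have c1 : c <= s / 2 by rewrite ge_min lexx.
  have c2 : c <= s * d ^+ 2 / 32 by rewrite ge_min lexx orbT.
  exists c => // x x' [Vx [x1 [xy xs]]] [Vx' [x'1 [x'y x's]]].
  rewrite -(@ltr_pXn2r _ 2)// ?nnegrE ?nrm_ge0 ?(ltW d0)//.
  have h1 := parallelogram x x'.
  have h2 := Vs _ (subspaceD sV Vx Vx'); rewrite linD// in h2.
  have h3 : 2 * s - 4 * c <= nrm (B x + B x').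
    have := ler_nrmB (B x + B x') (B x' - B x).
    have -> : B x + B x' - (B x' - B x) = 2%:C *: B x.
      by rewrite opprB addrACA subrr addr0 rmorphD scalerDl scale1r.
    rewrite nrmZ ger0_norm//.
    have := ler_nrmD (B x' - y) (y - B x); rewrite subrKA (nrmB _ y).
    by lra.
  have h4 : 2 * s - 4 * c <= s * nrm (x + x') by lra.
  have h5 : 0 <= 2 * s - 4 * c by lra.
  have h6 : (2 * s - 4 * c) ^+ 2 <= s ^+ 2 * nrm (x + x') ^+ 2.
    rewrite -exprMn ler_pXn2r// nnegrE ?mulr_ge0 ?nrm_ge0//.
  have h7 : nrm x ^+ 2 <= 1 by rewrite expr_le1 ?nrm_ge0.
  have h8 : nrm x' ^+ 2 <= 1 by rewrite expr_le1 ?nrm_ge0.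
  have h9 : s ^+ 2 * nrm (x - x') ^+ 2 <= 16 * s * c.
    have := sqr_ge0 c.
    have : s ^+ 2 * nrm (x - x') ^+ 2 <= s ^+ 2 * (4 - nrm (x + x') ^+ 2).
      by rewrite ler_wpM2l ?exprn_ge0//; lra.
    by lra.
  have s20 : 0 < s ^+ 2 by rewrite exprn_gt0.
  rewrite -(ltr_pM2l s20); apply: le_lt_trans h9 _.
  have : s * c <= s * (s * d ^+ 2 / 32) by rewrite ler_wpM2l.
  have : 0 < s ^+ 2 * d ^+ 2 by rewrite mulr_gt0// exprn_gt0.
  by lra.
have xlim d : 0 < d -> exists z, [/\ V z, nrm z <= 1, s - d < nrm (B z) & nrm (x - z) < d].
  move=> d0; have /closure_nrmP/(_ _ d0)[z [Vz [z1 [_ zs]]] xz] := xP d d0.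
  by exists z.
have Vx : V x.
  by apply: cV; apply/closure_nrmP => d d0; have [z [Vz _ _ xz]] := xlim d d0; exists z.
exists x; split=> //.
  apply/ler_addgt0Pr => d d0; have [z [_ z1 _ xz]] := xlim d d0.
  by have := ler_nrm_dist x z; lra.
move=> z Vz; apply: le_trans (Vs z Vz) _; apply: ler_wpM2r; first exact: nrm_ge0.
apply/ler_addgt0Pr => d d0.
have M1 : 0 < M + 1 by lra.
have [w [_ _ ws xw]] := xlim (d / (M + 1)) (divr_gt0 d0 M1).
have := ler_nrm_dist (B w) (B x); rewrite -linB// => h1.
have h2 := BM (w - x); rewrite nrmB in xw.
have : (M + 1) * (d / (M + 1)) = d by rewrite mulrC divfK// gt_eqF.
have := nrm_ge0 (w - x).
set c := d / (M + 1) in ws xw *; nra.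
Qed.

(** The weak form of B* B x = l ^ 2 x. *)
Definition sing_vect B (l : R) x := forall y, '[B x, B y] = (l ^+ 2)%:C * '[x, y].

(** The choice of e k in the greedy construction of the singular vectors of B.
    Only a norm at most 1 is required, so that 0 can be chosen when e 0, ..., e (k - 1)
    already span the space. The vector e k is a unit vector as soon as B (e k) != 0. *)
Definition greedy_at B e k := [/\ nrm (e k) <= 1,
  forall i, (i < k)%N -> '[e k, e i] = 0 &
  forall x, (forall i, (i < k)%N -> '[x, e i] = 0) -> nrm (B x) <= nrm (B (e k)) * nrm x].

Definition greedy B e := forall k, greedy_at B e k.

Lemma greedy_extend B e k : bounded_op B -> compact_op B ->
  exists z, greedy_at B (fun i => if (i < k)%N then e i else z) k.
Proof.
move=> bB cB; pose S := [set e i | i in [set i | (i < k)%N]].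
have [z [Vz z1 zmax]] := compact_op_max bB cB (subspace_orth S) (@closed_orth S).
exists z; rewrite /greedy_at ltnn; split=> // [i ik|x hx].
  by rewrite ik; apply: Vz; exists i.
by apply: zmax => _ [i /= ik <-]; have := hx i ik; rewrite ik.
Qed.

Lemma eq_greedy_at B e f k : (forall i, (i <= k)%N -> e i = f i) ->
  greedy_at B e k -> greedy_at B f k.
Proof.
move=> ef [e1 e2 e3]; split; rewrite -?ef//.
  by move=> i ik; rewrite -(ef i) ?(ltnW ik)//; exact: e2.
by move=> x hx; apply: e3 => i ik; rewrite ef ?(ltnW ik)//; exact: hx.
Qed.

Lemma greedy_exists B : bounded_op B -> compact_op B -> exists e, greedy B e.
Proof.
move=> bB cB.
have [g gP] := choice (fun ek : (nat -> H) * nat => greedy_extend ek.1 ek.2 bB cB).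
pose pre := fix pre k := if k is k'.+1 then
  fun i => if (i < k')%N then pre k' i else g (pre k', k') else fun=> 0.
pose e k := pre k.+1 k.
have preE k i : (i < k)%N -> pre k i = e i.
  elim: k => // k IH; rewrite ltnS leq_eqVlt => /predU1P[->//|ik].
  by rewrite /= ik IH.
exists e => k; apply: eq_greedy_at (gP (pre k, k)) => i /=.
rewrite leq_eqVlt => /predU1P[->|ik]; first by rewrite ltnn /e /= ltnn.
by rewrite ik preE.
Qed.

Lemma greedy_nonincr B e j k : greedy_at B e j -> greedy_at B e k -> (j <= k)%N ->
  nrm (B (e k)) <= nrm (B (e j)).
Proof.
move=> [_ _ mj] [k1 ok _] jk; apply: le_trans (mj _ _) _.
  by move=> i ij; apply: ok; exact: leq_trans ij jk.
by rewrite -[leRHS]mulr1 ler_wpM2l ?nrm_ge0.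
Qed.

Lemma greedy_unit B e k : greedy_at B e k -> 0 < nrm (B (e k)) -> nrm (e k) = 1.
Proof.
move=> [k1 ok mk] s0; apply/le_anti; rewrite k1 /=.
by have := mk _ ok; rewrite -{1}[nrm (B _)]mulr1 ler_pM2l.
Qed.

Lemma orth_remainder e k y : (forall i, (i < k)%N -> nrm (e i) = 1) ->
  (forall i j, (i < j)%N -> (j < k)%N -> '[e j, e i] = 0) ->
  forall j, (j < k)%N -> '[y - \sum_(i < k) '[y, e i] *: e i, e j] = 0.
Proof.
move=> e1 oe j jk; rewrite hdotBl hdot_suml (bigD1 (Ordinal jk))//= big1 ?addr0.
  by rewrite hdotZl hdot_self e1// expr1n mulr1 subrr.
move=> i ij; rewrite hdotZl.
have {}ij : (i != j :> nat) by [].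
case: (ltngtP i j) ij => // ij _; first by rewrite (hdot0C (oe _ _ ij jk)) mulr0.
by rewrite oe// mulr0.
Qed.

(** On the orthogonal complement of e 0, ..., e (k - 1) this is the first-order
    condition for the maximum at e k. On the e i with i < k both sides vanish, by
    the same identity for e i. *)
Lemma greedy_sing_vect B e k : linear B -> (forall i, (i <= k)%N -> greedy_at B e i) ->
  sing_vect B (nrm (B (e k))) (e k).
Proof.
move=> lB; elim/ltn_ind: k => k IH ge y.
set s := nrm (B (e k)); have [k1 ok mk] := ge k (leqnn k).
have [s0|s_neq0] := eqVneq s 0.
  have /eqP-> : B (e k) == 0 by rewrite -nrm_eq0 -/s s0.
  by rewrite s0 linear0l expr0n mul0r.
have s0 : 0 < s by rewrite lt_def s_neq0 nrm_ge0.
have ek1 : nrm (e k) = 1 by apply: greedy_unit s0; exact: ge.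
have onV v : (forall i, (i < k)%N -> '[v, e i] = 0) ->
    '[B (e k), B v] = (s ^+ 2)%:C * '[e k, v].
  have real w : (forall i, (i < k)%N -> '[w, e i] = 0) ->
      rdot (B (e k)) (B w) = s ^+ 2 * rdot (e k) w.
    move=> ow; apply/eqP; rewrite eq_sym -subr_eq0; apply/eqP.
    apply: (@quad_ge0_lin0 _ _ (s ^+ 2 * nrm w ^+ 2 - nrm (B w) ^+ 2)) => t.
    have : nrm (B (e k + t%:C *: w)) <= s * nrm (e k + t%:C *: w).
      by apply: mk => i ik; rewrite hdotDl hdotZl ok// ow// mulr0 addr0.
    rewrite -(@ler_pXn2r _ 2)// ?nnegrE ?nrm_ge0 ?mulr_ge0 ?nrm_ge0//.
    rewrite linD// linZ// exprMn !nrmD2 !nrmZ !exprMn real_normK ?num_real//.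
    by rewrite !rdotZr -/s ek1; lra.
  move=> ov; rewrite hdotE -linZ// !real//; last first.
    by move=> i ik; rewrite hdotZl ov// mulr0.
  by rewrite [X in _ = _ * X]hdotE; simpc.
have pos i : (i < k)%N -> 0 < nrm (B (e i)).
  move=> ik; apply: lt_le_trans s0 _.
  exact: greedy_nonincr (ge i (ltnW ik)) (ge k (leqnn k)) (ltnW ik).
have ov : forall i, (i < k)%N -> '[y - \sum_(i < k) '[y, e i] *: e i, e i] = 0.
  apply: orth_remainder => [j jk|i j ij jk].
    by apply: greedy_unit (pos j jk); apply: ge; exact: ltnW.
  by have [_ oj _] := ge j (ltnW jk); exact: oj.
rewrite -(subrK (\sum_(i < k) '[y, e i] *: e i) y).
move: (y - _) ov => v ov; rewrite linD// !hdotDr onV//.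
rewrite mulrDr; congr (_ + _); rewrite lin_sum// !hdot_sumr mulr_sumr.
apply: eq_bigr => i _; rewrite !hdotZr mulrCA; congr (_ * _).
rewrite ok// mulr0 hdot0C// IH//; last by move=> j ji; apply: ge; exact: leq_trans ji (ltnW _).
by rewrite (hdot0C (ok _ _)) ?mulr0.
Qed.

(** Otherwise the images of the e k would be orthogonal and bounded away from
    0, hence separated. *)
Lemma greedy_small B e : compact_op B -> linear B -> greedy B e ->
  forall d, 0 < d -> exists k, nrm (B (e k)) < d.
Proof.
move=> cB lB ge d d0; apply: contrapT => h.
have big k : d <= nrm (B (e k)).
  by rewrite leNgt; apply/negP => kd; apply: h; exists k.
have [m [n [mn mnd]]] := compact_op_separated cB lB lB (fun=> lexx _) d0
  (fun k => let: And3 h _ _ := ge k in h).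
have : nrm (B (e n) - B (e m)) ^+ 2 = nrm (B (e n)) ^+ 2 + nrm (B (e m)) ^+ 2.
  rewrite nrmB2 rdot_hdot0 ?mulr0 ?subr0//; have [_ on _] := ge n.
  by rewrite (greedy_sing_vect lB)// on// mulr0.
have := big n; have := big m; have := nrm_ge0 (B (e n) - B (e m)); nra.
Qed.

(** There are k + 1 coefficients and k equations. *)
Lemma exists_comb_orth (k : nat) (g : 'I_k.+1 -> H) (e : nat -> H) :
  exists2 c : 'I_k.+1 -> R[i], (exists i, c i != 0) &
    forall j, (j < k)%N -> '[\sum_i c i *: g i, e j] = 0.
Proof.
pose M : 'M[R[i]]_(k.+1, k) := \matrix_(i, j) '[g i, e j].
have /rowV0Pn[c /sub_kermxP cM c0] : kermx M != 0.
  rewrite kermx_eq0 /row_free neq_ltn; apply/orP; left.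
  exact: leq_ltn_trans (rank_leq_col M) _.
exists (fun i => c 0 i) => [|j jk].
  apply: contrapT => h; case/eqP: c0; apply/rowP => i; rewrite mxE.
  by apply/eqP/negPn/negP => ci; apply: h; exists i.
have /rowP/(_ (Ordinal jk)) := cM; rewrite !mxE => <-.
rewrite hdot_suml; apply: eq_bigr => i _; rewrite mxE; exact: hdotZl.
Qed.

Lemma nrm_comb (n : nat) (g : 'I_n -> H) (c : 'I_n -> R[i]) :
  (forall i j, i != j -> '[g i, g j] = 0) ->
  nrm (\sum_i c i *: g i) ^+ 2 = \sum_i (complex.Re `|c i| * nrm (g i)) ^+ 2.
Proof.
move=> o; rewrite nrm_sum_orth => [|i j ij].
  by apply: eq_bigr => i _; rewrite nrmZC.
by apply: rdot_hdot0; rewrite hdotZl hdotZr o// !mulr0.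
Qed.

(** The Courant-Fischer bound: the span of g 0, ..., g k contains a nonzero
    vector orthogonal to e 0, ..., e (k - 1). On the span D is bounded below by t,
    and on the orthogonal complement B is bounded above by the norm of B (e k). *)
Lemma greedy_minmax B D e k (g : nat -> H) (t : R) :
  linear D -> (forall x, nrm (D x) <= nrm (B x)) -> greedy_at B e k -> 0 <= t ->
  (forall i, (i <= k)%N -> nrm (g i) = 1) ->
  (forall i j, (i < j)%N -> (j <= k)%N -> '[g j, g i] = 0) ->
  (forall i, (i <= k)%N -> sing_vect D (nrm (D (g i))) (g i) /\ t <= nrm (D (g i))) ->
  t <= nrm (B (e k)).
Proof.
move=> lD DB [_ _ mk] t0 g1 og sg.
have o (i j : 'I_k.+1) : i != j -> '[g i, g j] = 0.
  move=> ij; have {}ij : (i != j :> nat) by [].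
  case: (ltngtP i j) ij => // ij _; last by rewrite og// -ltnS.
  by rewrite hdot0C ?og// -ltnS.
have [c [i0 ci0] cP] := exists_comb_orth (fun i : 'I_k.+1 => g i) e.
set x := \sum_i _ in cP.
have nx : nrm x ^+ 2 = \sum_i complex.Re `|c i| ^+ 2.
  by rewrite nrm_comb//; apply: eq_bigr => i _; rewrite g1 ?mulr1// -ltnS.
have x0 : 0 < nrm x.
  rewrite lt_def nrm_ge0 andbT -sqrf_eq0 nx psumr_eq0; last by move=> i _; exact: sqr_ge0.
  apply/negP => /allP/(_ i0); rewrite mem_index_enum => /(_ isT).
  rewrite implyTb sqrf_eq0 => /eqP ci; case/eqP: ci0.
  by apply/eqP; rewrite -normr_eq0 (ge0_ReE (normr_ge0 _)) ci.
have lower : t * nrm x <= nrm (D x).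
  rewrite -(@ler_pXn2r _ 2)// ?nnegrE ?nrm_ge0 ?mulr_ge0 ?nrm_ge0//.
  rewrite exprMn nx lin_sum// nrm_comb => [|i j ij].
    rewrite mulr_sumr; apply: ler_sum => i _; rewrite exprMn mulrC.
    have ik : (i <= k)%N by rewrite -ltnS.
    by rewrite ler_wpM2l ?sqr_ge0// ler_pXn2r ?nnegrE ?nrm_ge0//; exact: (sg i ik).2.
  by rewrite (sg i _).1 ?o ?mulr0// -ltnS.
by rewrite -(ler_pM2r x0); apply: le_trans lower (le_trans (DB x) (mk x cP)).
Qed.

End GreedyDiagonalization.

(** * Comparison of singular values *)

Section Weyl.
Variables (R : realType) (H : hilbertType R[i]).
Implicit Types (x y z : H) (a b t : R) (B D T : H -> H) (e f : nat -> H).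

Lemma greedy_orth B e i j : greedy B e -> i != j -> '[e i, e j] = 0.
Proof.
move=> ge; case: (ltngtP i j) => // ij _.
  by apply: hdot0C; have [_ + _] := ge j; exact.
by have [_ + _] := ge i; exact.
Qed.

Lemma greedy_le B D e f : linear B -> linear D -> greedy B e -> greedy D f ->
  (forall x, nrm (D x) <= nrm (B x)) -> forall k, nrm (D (f k)) <= nrm (B (e k)).
Proof.
move=> lB lD ge gf DB k.
have [->|s_neq0] := eqVneq (nrm (D (f k))) 0; first exact: nrm_ge0.
have s0 : 0 < nrm (D (f k)) by rewrite lt_def s_neq0 nrm_ge0.
have le i : (i <= k)%N -> nrm (D (f k)) <= nrm (D (f i)).
  by move=> ik; exact: greedy_nonincr (gf i) (gf k) ik.
apply: (greedy_minmax lD DB (ge k) (nrm_ge0 _) (g := f)) => [i ik|i j ij _|i ik].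
- by apply: (greedy_unit (gf i)); exact: lt_le_trans s0 (le i ik).
- by rewrite (greedy_orth gf)// gtn_eqF.
- by split; [apply: greedy_sing_vect => // j _; exact: gf|exact: le].
Qed.

(** By induction on k: f 0, ..., f (k - 1) are the first choices of a greedy
    sequence for B. If the next choice z for B gave more than the k-th singular
    value of B, then f 0, ..., f (k - 1), z would contradict greedy_minmax. So f k,
    which attains the k-th singular value already for D, is a correct choice. *)
Lemma greedy_transfer B D e f : bounded_op B -> compact_op B -> linear D ->
  greedy B e -> greedy D f -> (forall x, nrm (D x) <= nrm (B x)) ->
  (forall k, nrm (D (f k)) = nrm (B (e k))) ->
  greedy B f /\ forall k, nrm (B (f k)) = nrm (D (f k)).
Proof.
move=> bB cB lD ge gf DB eqs; have lB := bB.1.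
suff max k : forall x, (forall i, (i < k)%N -> '[x, f i] = 0) ->
    nrm (B x) <= nrm (B (e k)) * nrm x.
  have Bf k : nrm (B (f k)) = nrm (D (f k)).
    have [f1 of_ _] := gf k; apply/le_anti; rewrite DB andbT eqs.
    apply: le_trans (max k _ of_) _.
    by rewrite -[leRHS]mulr1 ler_wpM2l ?nrm_ge0.
  split=> // k; have [f1 of_ _] := gf k; split=> // x ox.
  by rewrite Bf eqs; exact: max.
elim/ltn_ind: k => k IH x ox.
have fk i : (i < k)%N -> greedy_at B f i /\ nrm (B (f i)) = nrm (B (e i)).
  move=> ik; have [f1 of_ _] := gf i.
  have Bf : nrm (B (f i)) = nrm (B (e i)).
    apply/le_anti; rewrite -{2}eqs DB andbT.
    apply: le_trans (IH i ik _ of_) _.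
    by rewrite -[leRHS]mulr1 ler_wpM2l ?nrm_ge0.
  by split=> //; split=> // y oy; rewrite Bf; exact: IH.
have [z] := greedy_extend f k bB cB.
set f' := fun i => _ => gz.
have f'i i : (i < k)%N -> f' i = f i by rewrite /f' => ->.
have f'k : f' k = z by rewrite /f' ltnn.
have gf' i : (i <= k)%N -> greedy_at B f' i.
  rewrite leq_eqVlt => /predU1P[->//|ik].
  apply: eq_greedy_at (fk i ik).1 => j ji; rewrite f'i//.
  exact: leq_ltn_trans ji ik.
have [z1 oz mz] := gz.
have {}mz : nrm (B x) <= nrm (B z) * nrm x.
  by rewrite -f'k; apply: mz => i ik; rewrite f'i//; exact: ox.
apply: le_trans mz _; apply: ler_wpM2r; first exact: nrm_ge0.
have [->|t_neq0] := eqVneq (nrm (B z)) 0; first exact: nrm_ge0.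
have t0 : 0 < nrm (B z) by rewrite lt_def t_neq0 nrm_ge0.
have le i : (i <= k)%N -> nrm (B z) <= nrm (B (f' i)).
  by move=> ik; rewrite -f'k; exact: greedy_nonincr (gf' i ik) gz ik.
apply: (greedy_minmax lB (fun=> lexx _) (ge k) (nrm_ge0 _) (g := f')) => [i ik|i j ij jk|i ik].
- by apply: (greedy_unit (gf' i ik)); exact: lt_le_trans t0 (le i ik).
- by have [_ + _] := gf' j jk; apply.
- split; last exact: le.
  by apply: greedy_sing_vect => // j ji; apply: gf'; exact: leq_trans ji ik.
Qed.

(** Both operators act alike on the span of f 0, ..., f (k - 1), and both are
    small on its orthogonal complement when k is large. *)
Lemma greedy_nrm_eq B D f : bounded_op B -> compact_op B -> bounded_op D ->
  greedy B f -> greedy D f -> (forall k, nrm (B (f k)) = nrm (D (f k))) ->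
  forall x, nrm (B x) = nrm (D x).
Proof.
move=> [lB _] cB [lD _] gB gD eqs x.
have key d : 0 < d -> `|nrm (B x) ^+ 2 - nrm (D x) ^+ 2| <= d ^+ 2 * nrm x ^+ 2.
  move=> d0.
  have exK : exists k, nrm (B (f k)) < d := greedy_small cB lB gB d0.
  have [k kd kmin] := ex_minnP exK.
  have big i : (i < k)%N -> 0 < nrm (B (f i)).
    move=> ik; apply: lt_le_trans d0 _; rewrite leNgt; apply/negP => /kmin.
    by rewrite leqNgt ik.
  pose p := \sum_(i < k) '[x, f i] *: f i.
  have ov : forall i, (i < k)%N -> '[x - p, f i] = 0.
    apply: orth_remainder => [i ik|i j ij jk]; first exact: greedy_unit (gB i) (big i ik).
    by rewrite (greedy_orth gB)// gtn_eqF.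
  have pyth T : linear T -> greedy T f ->
      nrm (T x) ^+ 2 = nrm (T p) ^+ 2 + nrm (T (x - p)) ^+ 2.
    move=> lT gT; rewrite (_ : T x = T p + T (x - p)); last first.
      by rewrite -linD// addrC subrK.
    rewrite nrmD2.
    rewrite (_ : rdot _ _ = 0) ?mulr0 ?addr0//; apply: rdot_hdot0.
    rewrite lin_sum// hdot_suml big1// => i _.
    rewrite hdotZl (greedy_sing_vect lT)//.
    by rewrite (hdot0C (ov _ _))// !mulr0.
  have eqp : nrm (B p) ^+ 2 = nrm (D p) ^+ 2.
    have nT T : linear T -> greedy T f ->
        nrm (T p) ^+ 2 = \sum_(i < k) (complex.Re `|'[x, f i]| * nrm (T (f i))) ^+ 2.
      move=> lT gT; rewrite lin_sum// nrm_comb// => i j ij.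
      rewrite (greedy_sing_vect lT)//.
      by rewrite (greedy_orth gT) ?mulr0.
    by rewrite !nT//; apply: eq_bigr => i _; rewrite eqs.
  have small T : linear T -> greedy T f -> nrm (T (f k)) < d ->
      nrm (T (x - p)) ^+ 2 <= d ^+ 2 * nrm x ^+ 2.
    move=> lT gT Td; have [_ _ mk] := gT k.
    rewrite -exprMn ler_pXn2r ?nnegrE ?nrm_ge0 ?mulr_ge0 ?nrm_ge0 ?(ltW d0)//.
    apply: le_trans (mk _ ov) _; apply: ler_pM; rewrite ?nrm_ge0 ?(ltW Td)//.
    rewrite -(@ler_pXn2r _ 2) ?nnegrE ?nrm_ge0// -[x in leRHS](subrK p x) [leRHS]nrmD2.
    rewrite (_ : rdot _ _ = 0); first by have := sqr_ge0 (nrm p); lra.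
    apply: rdot_hdot0; rewrite hdot_sumr big1// => i _.
    by rewrite hdotZr ov// mulr0.
  rewrite (pyth B)// (pyth D)// eqp opprD addrACA subrr add0r.
  have := small B lB gB kd; have := small D lD gD; rewrite -eqs => /(_ kd).
  have := sqr_ge0 (nrm (B (x - p))); have := sqr_ge0 (nrm (D (x - p))).
  by rewrite ler_norml => *; apply/andP; split; lra.
suff : nrm (B x) ^+ 2 = nrm (D x) ^+ 2.
  by move/eqP; rewrite eqrXn2 ?nrm_ge0// => /eqP.
apply/eqP; rewrite -subr_eq0 -normr_le0; apply/ler_addgt0Pr => d d0; rewrite add0r.
have n1 : 0 < nrm x ^+ 2 + 1 by rewrite ltr_wpDl ?sqr_ge0.
have c0 : 0 < d / (nrm x ^+ 2 + 1) by rewrite divr_gt0.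
have sc0 : 0 < Num.sqrt (d / (nrm x ^+ 2 + 1)) by rewrite sqrtr_gt0.
apply: le_trans (key _ sc0) _; rewrite sqr_sqrtr ?(ltW c0)//.
by rewrite mulrAC ler_pdivrMr// ler_pM2l// lerDl.
Qed.

Lemma sing_vect_subspace B l : linear B -> is_subspace [set x | sing_vect B l x].
Proof.
move=> lB; split=> [y|c x y hx hy z].
  by rewrite lin0// !linear0l mulr0.
by rewrite lB !hdotDl !hdotZl hx hy mulrDr mulrCA.
Qed.

Lemma sing_vect_orth B l m x y : 0 <= l -> 0 <= m -> l != m ->
  sing_vect B l x -> sing_vect B m y -> '[x, y] = 0.
Proof.
move=> l0 m0 lm hx hy; have := hx y.
have -> : '[B x, B y] = (m ^+ 2)%:C * '[x, y].
  by rewrite hdotC hy (hdotC x y); exact: conj_ReZ.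
move/eqP; rewrite -subr_eq0 -mulrBl mulf_eq0 -rmorphB => /orP[|/eqP//].
by rewrite eq_complex /= subr_eq0 eqxx andbT eqrXn2// eq_sym (negPf lm).
Qed.

(** More than m vectors of S have a nontrivial combination orthogonal to the
    m vectors g i, and it vanishes by completeness. *)
Lemma dimensionP (S : set H) (m : nat) (g : 'I_m -> H) :
  (forall i, S (g i)) -> (forall i, '[g i, g i] != 0) ->
  (forall i j, i != j -> '[g i, g j] = 0) ->
  is_subspace S -> (forall x, S x -> (forall i, '[x, g i] = 0) -> x = 0) ->
  dimension S = m%:R%:E.
Proof.
move=> Sg g0 og sS tot; apply/eqP; rewrite eq_le; apply/andP; split; last first.
  apply: ereal_sup_ubound; exists m => //; exists g; split=> // c cg i.
  have /(congr1 (fun x => '[x, g i])) := cg; rewrite hdot_suml linear0l.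
  rewrite (bigD1 i)//= big1 ?addr0 => [|j ji]; last by rewrite hdotZl og ?mulr0.
  by rewrite hdotZl => /eqP; rewrite mulf_eq0 (negPf (g0 i)) orbF => /eqP.
apply: ge_ereal_sup => _ [n [v [li Sv]] <-]; rewrite lee_fin ler_nat leqNgt.
apply/negP => mn.
pose M : 'M[R[i]]_(n, m) := \matrix_(i, j) '[v i, g j].
have /rowV0Pn[c /sub_kermxP cM /eqP c0] : kermx M != 0.
  rewrite kermx_eq0 /row_free neq_ltn; apply/orP; left.
  exact: leq_ltn_trans (rank_leq_col M) _.
apply: c0; apply/rowP => i; rewrite mxE; apply: (li (fun i => c 0 i)).
apply: tot => [|j].
  elim/big_ind: _ => [|x y Sx Sy|k _]; first exact: sS.1.
    exact: subspaceD.
  by apply: subspaceZ.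
have /rowP/(_ j) := cM; rewrite !mxE => <-.
by rewrite hdot_suml; apply: eq_bigr => k _; rewrite mxE hdotZl.
Qed.

(** The e k with singular value l are an orthogonal basis of the eigenspace:
    an eigenvector orthogonal to them is also orthogonal to the e k with other
    singular values, hence lies where B is bounded by a singular value less
    than l. *)
Lemma dimension_greedy B e l (c : R) : bounded_op B -> compact_op B -> greedy B e ->
  0 < l -> 0 <= c ->
  (dimension [set x | sing_vect B l x] * c%:E =
   \esum_(k in [set k | nrm (B (e k)) = l]) c%:E)%E.
Proof.
move=> [lB _] cB ge l0 c0; have [K Kl] := greedy_small cB lB ge l0.
have small k : nrm (B (e k)) = l -> (k < K)%N.
  move=> kl; rewrite ltnNge; apply/negP => Kk.
  by have := greedy_nonincr (ge K) (ge k) Kk; rewrite kl leNgt Kl.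
pose P := [pred k : 'I_K | nrm (B (e k)) == l].
have Pl (i : 'I_#|P|) : nrm (B (e (enum_val i))) = l.
  by have := enum_valP i; rewrite inE => /eqP.
rewrite (@dimensionP _ #|P| (fun i => e (enum_val i))).
- have -> : [set k | nrm (B (e k)) = l] = `I_K `&` [set k | nrm (B (e k)) = l].
    by apply/seteqP; split=> k //= => [h|[]//]; split=> //; exact: small.
  rewrite esum_mkcondr esum_fset//; last by move=> k _; case: ifP.
  rewrite -fsbig_ord -big_mkcond /= sumEFin sumr_const -EFinM mulr_natl.
  congr ((_ *+ _)%:E).
  by apply: eq_card => k; rewrite !inE; apply/eqP/idP => [/mem_set|/set_mem].
- by move=> i; rewrite /= -(Pl i); apply: greedy_sing_vect => // j _; exact: ge.
- move=> i; rewrite hdot_self (greedy_unit (ge _)) ?Pl//.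
  by rewrite expr1n oner_neq0.
- move=> i j ij; apply: (greedy_orth ge); apply: contraNneq ij => ij.
  by apply/eqP/enum_val_inj/val_inj.
- exact: sing_vect_subspace.
move=> x hx ox.
have oK i : (i < K)%N -> '[x, e i] = 0.
  move=> iK; have [il|il] := eqVneq (nrm (B (e i))) l.
    have iP : Ordinal iK \in P by rewrite inE /= il.
    by have := ox (enum_rank_in iP (Ordinal iK)); rewrite enum_rankK_in.
  apply: (sing_vect_orth (ltW l0) (nrm_ge0 _) _ hx); first by rewrite eq_sym; exact: il.
  by apply: greedy_sing_vect => // j _; exact: ge.
have [_ _ mK] := ge K; have h := mK x oK.
have : nrm (B x) = l * nrm x.
  apply/eqP; rewrite -(@eqrXn2 _ 2)// ?nrm_ge0 ?mulr_ge0 ?nrm_ge0 ?(ltW l0)//.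
  by rewrite exprMn !nrm2 /rdot hx ReZ.
move=> Bx; rewrite Bx in h; apply/eqP; rewrite -nrm_eq0; apply/eqP.
by have := nrm_ge0 x; nra.
Qed.

(** The eigenvalue sum, grouped by value, becomes a series over k; the terms of
    this series can be compared for two operators one by one. *)
Lemma esum_singular_values B e (p : R) : 0 < p -> bounded_op B -> compact_op B -> greedy B e ->
  (\esum_(l in [set l : R | (0 < l)%R])
     dimension [set x | sing_vect B l x] * (l `^ p)%:E =
   \esum_(k in setT) (nrm (B (e k)) `^ p)%:E)%E.
Proof.
move=> p0 bB cB ge; set s := fun k => nrm (B (e k)).
have E l : 0 < l -> (dimension [set x | sing_vect B l x] * (l `^ p)%:E =
    \esum_(k in [set k | s k = l]) (s k `^ p)%:E)%E.
  move=> l0; rewrite (dimension_greedy bB cB ge l0) ?powR_ge0//.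
  by apply: eq_esum => k /= sk; rewrite /s sk.
rewrite (eq_esum E) esum_esum; last by move=> *; rewrite lee_fin powR_ge0.
transitivity (\esum_(k in [set k | (0 < s k)%R]) (s k `^ p)%:E)%E.
  rewrite (reindex_esum [set k | 0 < s k] _ (fun k => (s k, k)))//.
  split=> [k /= sk|k k' _ _ []//|[l k] /= [l0 sk]]; first by split.
  by exists k; rewrite /= sk.
rewrite esum_mkcond; apply: eq_esum => k _; case: ifPn => // /negP sk.
rewrite (_ : nrm (B (e k)) = 0); last first.
  by apply/le_anti; rewrite nrm_ge0 andbT leNgt; apply/negP => h; apply: sk; rewrite inE.
by rewrite powR0// gt_eqF.
Qed.
End Weyl.

(** * Square roots of positive operators *)

Section SquareRoot.
Variables (R : realType) (H : hilbertType R[i]).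
Implicit Types (x y z : H) (a b t : R) (B D T W : H -> H).

Lemma rdotii x y : rdot ('i *: x) ('i *: y) = rdot x y.
Proof.
rewrite /rdot hdotZl hdotZr mulrA.
by rewrite (_ : 'i * _ = 1) ?mul1r//; simpc.
Qed.

Lemma scaleii x : 'i *: ('i *: x) = - x.
Proof. by rewrite scalerA (_ : 'i * 'i = -1) ?scaleN1r//; simpc. Qed.

Lemma sym_hdot T : linear T -> (forall x y, rdot (T x) y = rdot x (T y)) ->
  forall x y, '[T x, y] = '[x, T y].
Proof. by move=> lT h x y; apply: hdot_eqP; rewrite h// linZ. Qed.

(** Polarization: the imaginary part of the quadratic form vanishes. *)
Lemma psd_sym T : psd_op T -> forall x y, '[T x, y] = '[x, T y].
Proof.
move=> [[lT _] T0]; apply: sym_hdot => // x y.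
have skew u : rdot (T u) ('i *: u) = 0.
  by have := T0 u; rewrite hdotE lecE /= => /andP[/eqP].
have pol u v : rdot (T u) ('i *: v) = - rdot (T v) ('i *: u).
  have := skew (u + v); rewrite scalerDr linD// !rdotDl !rdotDr !skew.
  by lra.
have := pol x ('i *: y).
by rewrite scaleii rdotNr linZ// rdotii => /oppr_inj ->; exact: rdotC.
Qed.

Lemma psd_rdot_ge0 T x : psd_op T -> 0 <= rdot (T x) x.
Proof. by move=> [_ /(_ x)]; rewrite hdotE lecE /= => /andP[_]. Qed.

Lemma psdP T : psd_op T <->
  [/\ bounded_op T, forall x y, '[T x, y] = '[x, T y] & forall x, 0 <= rdot (T x) x].
Proof.
split=> [pT|[bT sT T0]].
  by split=> [|x y|x]; [exact: pT.1|exact: psd_sym|exact: psd_rdot_ge0].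
split=> // x; rewrite hdotE lecE /= T0 andbT.
have := sT x x; rewrite [RHS]hdotC !hdotE => -[] /eqP.
by rewrite eq_sym eqNr.
Qed.

(** Positivity at x - T x / M. *)
Lemma psd_nrm_le T M : psd_op T -> 0 < M -> (forall x, nrm (T x) <= M * nrm x) ->
  forall x, nrm (T x) ^+ 2 <= M * rdot (T x) x.
Proof.
move=> pT M0 TM x; have [[lT _] _] := pT.
have := psd_rdot_ge0 (x - M^-1%:C *: T x) pT.
rewrite linB// linZ// rdotBl !rdotBr !rdotZl !rdotZr.
have -> : rdot (T (T x)) x = nrm (T x) ^+ 2.
  by rewrite nrm2 /rdot psd_sym.
have h := le_trans (rdot_le (T (T x)) (T x)) (ler_wpM2r (nrm_ge0 (T x)) (TM (T x))).
rewrite -nrm2 => h'; rewrite -ler_pdivrMl//.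
have : M^-1 * (M^-1 * rdot (T (T x)) (T x)) <= M^-1 * nrm (T x) ^+ 2.
  rewrite ler_wpM2l ?invr_ge0 ?(ltW M0)// ler_pdivrMl//.
  by rewrite expr2 mulrA.
by lra.
Qed.

Section Iteration.
Variable B : H -> H.
Hypotheses (lB : linear B) (symB : forall x y, '[B x, y] = '[x, B y])
  (B1 : forall x, nrm (B x) <= nrm x).

(** The iteration Y' = (B + Y ^ 2) / 2 converges to 1 - sqrt (1 - B). Its
    steps are dominated by those of the same iteration for the scalar B = 1, which
    increases to 1; so convergence needs no commutation or monotonicity of the
    operators. *)
Fixpoint root_iter (n : nat) (x : H) : H :=
  if n is m.+1 then (2^-1 : R)%:C *: (B x + root_iter m (root_iter m x)) else 0.
Fixpoint scal_iter (n : nat) : R :=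
  if n is m.+1 then 2^-1 * (1 + scal_iter m ^+ 2) else 0.

Lemma scal_iter_bounds n : 0 <= scal_iter n <= 1.
Proof. by elim: n => [|n /andP[h1 h2]] /=; apply/andP; split; nra. Qed.

Lemma scal_iter_nondecr n : scal_iter n <= scal_iter n.+1.
Proof. by have := sqr_ge0 (1 - scal_iter n) => /=; lra. Qed.

(** The error d satisfies d' = d - d ^ 2 / 2, which is increasing in d on the unit
    interval. *)
Lemma scal_iter_cvg n : 1 - scal_iter n <= 2 / n.+2%:R.
Proof.
elim: n => [|n IH] /=; first by rewrite subr0 divff.
have /andP[h1 h2] := scal_iter_bounds n.
rewrite ler_pdivlMr// in IH; rewrite ler_pdivlMr//.
rewrite -[n.+3%:R]natr1; set m : R := n.+2%:R in IH *.
have m2 : 2 <= m by rewrite ler_nat.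
set d := 1 - scal_iter n in IH *.
have -> : 1 - 2^-1 * (1 + scal_iter n ^+ 2) = d - d ^+ 2 / 2 by rewrite /d; field.
have d0 : 0 <= d by rewrite /d; lra.
have d1 : d <= 1 by rewrite /d; lra.
nra.
Qed.

Lemma scal_iter_lim (C : R) : 0 <= C -> forall d, 0 < d ->
  exists n, (1 - scal_iter n) * C < d.
Proof.
move=> C0 d d0; have C1 : 0 < 2 * C + 1 by lra.
have e0 : 0 < d / (2 * C + 1) by rewrite divr_gt0.
have [N _ /(_ N (leqnn N)) /= NP] := near_infty_natSinv_lt (PosNum e0).
exists N; have := scal_iter_cvg N; have /andP[h1 h2] := scal_iter_bounds N.
move: NP; rewrite ltr_pdivlMr// ltr_pdivrMl//.
rewrite ler_pdivlMr// -[N.+2%:R]natr1; set m : R := N.+1%:R => NP h3.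
have m1 : 1 <= m by rewrite ler1n.
set s := 1 - _ in h3 *.
have : s * m * C <= 2 * C by rewrite ler_wpM2r//; rewrite /s in h3 *; lra.
move=> h4; have : m * (s * C) < m * d by lra.
by rewrite ltr_pM2l//; lra.
Qed.

Lemma root_iter_lin n : linear (root_iter n).
Proof.
elim: n => [|n IH] c x y /=; first by rewrite scaler0 addr0.
rewrite lB !IH !scalerDr !scalerA ![_ * c]mulrC -!addrA; congr (_ + _).
by rewrite addrCA.
Qed.

Lemma root_iter_sym n x y : '[root_iter n x, y] = '[x, root_iter n y].
Proof.
elim: n x y => [|n IH] x y /=; first by rewrite linear0l linear0r.
rewrite hdotZl hdotZr hdotDl hdotDr symB !IH; congr (_ * _).
exact/esym/conj_real.
Qed.

Lemma root_iter_nrm n x : nrm (root_iter n x) <= scal_iter n * nrm x.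
Proof.
elim: n x => [|n IH] x /=; first by rewrite nrm0 mul0r.
rewrite nrmZ ger0_norm//; have /andP[s0 s1] := scal_iter_bounds n.
have := ler_nrmD (B x) (root_iter n (root_iter n x)).
have := le_trans (IH (root_iter n x)) (ler_wpM2l s0 (IH x)).
by have := B1 x; lra.
Qed.

(** With Y, Z two consecutive iterates, Z ^ 2 - Y ^ 2 = Z (Z - Y) + (Z - Y) Y. *)
Lemma root_iter_step n x :
  nrm (root_iter n.+1 x - root_iter n x) <= (scal_iter n.+1 - scal_iter n) * nrm x.
Proof.
elim: n x => [|n IH] x.
  rewrite /= !subr0 addr0 nrmZ ger0_norm// expr0n addr0 mulr1.
  by rewrite ler_wpM2l.
set Y := root_iter n in IH *; set Z := root_iter n.+1 in IH *.
have -> : root_iter n.+2 x - Z x = (2^-1 : R)%:C *: (Z (Z x - Y x) + (Z (Y x) - Y (Y x))).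
  have e2 : root_iter n.+2 x = (2^-1 : R)%:C *: (B x + Z (Z x)) by [].
  have e1 : Z x = (2^-1 : R)%:C *: (B x + Y (Y x)) by [].
  rewrite e2 [X in _ - X]e1 -scalerBr /Z (linB _ _ (root_iter_lin n.+1)) -/Z.
  by rewrite subrKA opprD addrACA subrr add0r.
rewrite nrmZ ger0_norm//.
have := ler_nrmD (Z (Z x - Y x)) (Z (Y x) - Y (Y x)).
have /andP[z0 z1] := scal_iter_bounds n.+1.
have h1 := le_trans (root_iter_nrm n.+1 (Z x - Y x)) (ler_wpM2l z0 (IH x)).
have d0 : 0 <= scal_iter n.+1 - scal_iter n by rewrite subr_ge0 scal_iter_nondecr.
have h2 := le_trans (IH (Y x)) (ler_wpM2l d0 (root_iter_nrm n x)).
have -> : scal_iter n.+2 = 2^-1 * (1 + scal_iter n.+1 ^+ 2) by [].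
have : scal_iter n.+1 = 2^-1 * (1 + scal_iter n ^+ 2) by [].
move: h1 h2; rewrite -/Z; set zz := scal_iter n.+1; set yy := scal_iter n.
set p := nrm (Z _); set q := nrm (Z _ - _); set r := nrm (_ + _); move=> h1 h2 h3 h4.
have -> : (2^-1 * (1 + zz ^+ 2) - zz) * nrm x =
  2^-1 * (zz * ((zz - yy) * nrm x) + (zz - yy) * (yy * nrm x)).
  by rewrite [in X in _ - X]h3; ring.
by lra.
Qed.

(** The root is 1 - Y with Y the limit of the iteration: since 2 Y = B + Y ^ 2,
    its square is 1 - B. *)
Lemma root_exists : exists S, psd_op S /\ forall x, S (S x) = x - B x.
Proof.
have lim x : exists y, forall n, nrm (y - root_iter n x) <= (1 - scal_iter n) * nrm x.
  apply: (@dominated_limit _ _ (fun n => root_iter n x)) => [n|n|d d0].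
  - by have := root_iter_step n x; lra.
  - by have /andP[_ h] := scal_iter_bounds n; rewrite mulr_ge0 ?nrm_ge0// subr_ge0.
  - exact: scal_iter_lim (nrm_ge0 x) _ d0.
have [Y YP] := choice lim.
have eqlim (u v : H) (C : R) : 0 <= C -> (forall n, nrm (u - v) <= (1 - scal_iter n) * C) -> u = v.
  move=> C0 h; apply/eqP; rewrite -subr_eq0 -nrm_eq0; apply/eqP/le_anti.
  rewrite nrm_ge0 andbT; apply/ler_addgt0Pr => d d0; rewrite add0r.
  by have [n /ltW nd] := scal_iter_lim C0 d0; exact: le_trans (h n) nd.
have Y1 x : nrm (Y x) <= nrm x.
  have := YP x 0%N; rewrite /= !subr0 mul1r; exact.
have lY : linear Y.
  move=> c x y; apply: (eqlim _ _ (nrm (c *: x + y) + (nrm (c *: x) + nrm y))).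
    by rewrite !addr_ge0 ?nrm_ge0.
  move=> n.
  have := ler_nrmB (Y (c *: x + y) - root_iter n (c *: x + y))
    (c *: (Y x - root_iter n x) + (Y y - root_iter n y)).
  have -> : Y (c *: x + y) - root_iter n (c *: x + y) -
    (c *: (Y x - root_iter n x) + (Y y - root_iter n y)) = Y (c *: x + y) - (c *: Y x + Y y).
    by rewrite root_iter_lin scalerBr addrACA -opprD opprB addrA subrK.
  have := ler_nrmD (c *: (Y x - root_iter n x)) (Y y - root_iter n y).
  have := YP (c *: x + y) n; have := YP y n.
  have : nrm (c *: (Y x - root_iter n x)) <= (1 - scal_iter n) * nrm (c *: x).
    rewrite !nrmZC mulrCA ler_wpM2l//.
    by have := normr_ge0 c; rewrite lecE => /andP[].
  by lra.
have YY x : Y x + Y x = B x + Y (Y x).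
  apply: (eqlim _ _ (3 * nrm x + nrm (Y x))); first by rewrite addr_ge0 ?mulr_ge0 ?nrm_ge0.
  move=> n.
  have e1 : root_iter n.+1 x + root_iter n.+1 x = B x + root_iter n (root_iter n x).
    by rewrite /= -scalerDl -rmorphD (_ : 2^-1 + 2^-1 = 1 :> R) ?scale1r//; field.
  have -> : Y x + Y x - (B x + Y (Y x)) =
     ((Y x - root_iter n.+1 x) + (Y x - root_iter n.+1 x)) -
     ((Y (Y x) - root_iter n (Y x)) + root_iter n (Y x - root_iter n x)).
    rewrite (linB _ _ (root_iter_lin n)) subrKA addrACA -opprD e1 opprB.
    by rewrite -[RHS]addrA; congr (_ + _); rewrite !opprD subrKA.
  have h1 := YP x n.+1; have h2 := YP (Y x) n.
  have h3 := root_iter_nrm n (Y x - root_iter n x).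
  have := ler_nrmB ((Y x - root_iter n.+1 x) + (Y x - root_iter n.+1 x))
     ((Y (Y x) - root_iter n (Y x)) + root_iter n (Y x - root_iter n x)).
  have := ler_nrmD (Y x - root_iter n.+1 x) (Y x - root_iter n.+1 x).
  have := ler_nrmD (Y (Y x) - root_iter n (Y x)) (root_iter n (Y x - root_iter n x)).
  have /andP[s0 s1] := scal_iter_bounds n.
  have h4 : scal_iter n * nrm (Y x - root_iter n x) <= (1 - scal_iter n) * nrm x.
    apply: le_trans _ (YP x n); rewrite -[leRHS]mul1r.
    by rewrite ler_wpM2r ?nrm_ge0.
  have h5 : (1 - scal_iter n.+1) * nrm x <= (1 - scal_iter n) * nrm x.
    by rewrite ler_wpM2r ?nrm_ge0// lerD2l lerN2 scal_iter_nondecr.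
  by lra.
have symY x y : '[Y x, y] = '[x, Y y].
  apply: sym_hdot => // {}x {}y; apply/eqP; rewrite -subr_eq0 -normr_le0.
  apply/ler_addgt0Pr => d d0; rewrite add0r.
  have xy0 : 0 <= 2 * (nrm x * nrm y) by rewrite !mulr_ge0 ?nrm_ge0.
  have [n /ltW nd] := scal_iter_lim xy0 d0; apply: le_trans nd.
  have -> : rdot (Y x) y - rdot x (Y y) =
      rdot (Y x - root_iter n x) y - rdot x (Y y - root_iter n y).
    rewrite rdotBl rdotBr (_ : rdot (root_iter n x) y = rdot x (root_iter n y)) ?opprB ?addrA ?subrK//.
    by rewrite /rdot root_iter_sym.
  apply: le_trans (ler_normB _ _) _.
  have h1 := le_trans (rdot_CS (Y x - root_iter n x) y) (ler_wpM2r (nrm_ge0 y) (YP x n)).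
  have h2 := le_trans (rdot_CS x (Y y - root_iter n y)) (ler_wpM2l (nrm_ge0 x) (YP y n)).
  by lra.
exists (fun x => x - Y x); split.
  apply/psdP; split=> [|x y|x].
  - apply/bounded_nrmP; split=> [c x y|].
      by rewrite lY scalerBr addrACA -opprD.
    exists 2 => // x; have := ler_nrmB x (Y x); have := Y1 x; lra.
  - by rewrite hdotBl hdotBr symY.
  rewrite rdotBl -nrm2 subr_ge0; apply: le_trans (rdot_le _ _) _.
  by rewrite expr2 ler_wpM2r ?nrm_ge0.
move=> x; rewrite linB// opprB -addrA; congr (_ + _).
by rewrite addrCA -opprD YY opprD addrCA subrr addr0.
Qed.
End Iteration.

(** Rescale W to W / M = 1 - B, with M a bound of W. *)
Lemma sqrt_op_exists W : psd_op W -> exists S, psd_op S /\ S \o S = W.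
Proof.
move=> pW; have /bounded_nrmP[lW [M' M'0 WM']] := pW.1.
pose M := M' + 1; have M0 : 0 < M by rewrite /M; lra.
have WM x : nrm (W x) <= M * nrm x.
  by have := WM' x; have := nrm_ge0 x; rewrite /M; lra.
pose B x := x - M^-1%:C *: W x.
have lB : linear B.
  move=> c x y; rewrite /B lW scalerDr !scalerA scalerBr scalerA addrACA -opprD.
  by rewrite [c * _]mulrC.
have symB x y : '[B x, y] = '[x, B y].
  rewrite hdotBl hdotBr hdotZl hdotZr psd_sym//; congr (_ - _ * _).
  exact/esym/conj_real.
have B1 x : nrm (B x) <= nrm x.
  rewrite -(@ler_pXn2r _ 2) ?nnegrE ?nrm_ge0// nrmB2 rdotZr nrmZ exprMn.
  rewrite real_normK ?num_real// [rdot x _]rdotC.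
  have h := psd_nrm_le pW M0 WM x; have Mi : 0 < M^-1 by rewrite invr_gt0.
  have : M^-1 ^+ 2 * nrm (W x) ^+ 2 <= M^-1 * rdot (W x) x.
    by rewrite expr2 -mulrA ler_wpM2l ?(ltW Mi)// ler_pdivrMl.
  have := mulr_ge0 (ltW Mi) (psd_rdot_ge0 x pW).
  by lra.
have [S [pS SS]] := root_exists lB symB B1.
have [[lS _] _] := pS.
exists (fun x => (Num.sqrt M)%:C *: S x); split; last first.
  apply/funext => x /=; rewrite linZ// scalerA -rmorphM -expr2 sqr_sqrtr ?(ltW M0)//.
  by rewrite SS /B opprB addrC subrK scalerA -rmorphM divff ?gt_eqF// scale1r.
apply/psdP; split=> [|x y|x].
- apply/bounded_nrmP; split=> [c x y|].
    by rewrite lS scalerDr !scalerA mulrC.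
  have /bounded_nrmP[_ [C C0 SC]] := pS.1.
  exists (Num.sqrt M * C) => [|x]; first by rewrite mulr_ge0 ?sqrtr_ge0.
  by rewrite nrmZ ger0_norm ?sqrtr_ge0// -mulrA ler_wpM2l ?sqrtr_ge0.
- rewrite hdotZl hdotZr psd_sym//; congr (_ * _); exact/esym/conj_real.
- by rewrite rdotZl mulr_ge0 ?sqrtr_ge0// psd_rdot_ge0.
Qed.

Lemma sqrt_opP W : psd_op W -> psd_op (sqrt_op W) /\ forall x, sqrt_op W (sqrt_op W x) = W x.
Proof.
move=> /sqrt_op_exists h; have [pS SS] := xgetPex (cst 0) h.
by split=> // x; rewrite -[in RHS]SS.
Qed.
End SquareRoot.

(** * Monotonicity of the Schatten norms *)

Section SchattenMonotone.
Variables (R : realType) (H : hilbertType R[i]).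
Implicit Types (x y z : H) (a b t p : R) (B D T W : H -> H).

Lemma bounded_comp S T : bounded_op S -> bounded_op T -> bounded_op (S \o T).
Proof.
move=> /bounded_nrmP[lS [M M0 SM]] /bounded_nrmP[lT [N N0 TN]].
apply/bounded_nrmP; split=> [c x y /=|]; first by rewrite lT lS.
exists (M * N) => [|x /=]; first exact: mulr_ge0.
by apply: le_trans (SM _) _; rewrite -mulrA ler_wpM2l.
Qed.

Lemma abs_opP T : bounded_op T ->
  psd_op (abs_op T) /\ forall x, abs_op T (abs_op T x) = adjoint T (T x).
Proof.
move=> bT; have [bA Aadj] := adjointP bT; apply: sqrt_opP; split; first exact: bounded_comp.
by move=> x /=; rewrite hdotC -Aadj -hdotC; exact: dnorm_ge0.
Qed.

(** For l > 0 the operator |T| + l is injective, so the kernels of |T| - l and of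
    |T| ^ 2 - l ^ 2 coincide. In this way the eigenspaces of |T| are determined by
    the form '[T x, T y] alone. *)
Lemma eigspace_abs T l : bounded_op T -> 0 < l ->
  eigspace (abs_op T) l = [set x | sing_vect T l x].
Proof.
move=> bT l0; have [pG GG] := abs_opP bT; have [_ Aadj] := adjointP bT.
have [[lG _] _] := pG; set G := abs_op T in pG GG lG *.
have TG x y : '[T x, T y] = '[G (G x), y].
  by rewrite GG hdotC Aadj -hdotC.
apply/seteqP; split=> x /=.
  move=> Gx y; rewrite TG Gx linZ// Gx scalerA -rmorphM -expr2; exact: hdotZl.
move=> hx; have GGx : G (G x) = (l ^+ 2)%:C *: x.
  by apply: hdot_ext => y; rewrite hdotC [RHS]hdotC -TG hx hdotZl.
pose z := G x - l%:C *: x.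
have : rdot (G z + l%:C *: z) z = 0.
  rewrite /z (linB _ _ lG) (linZ _ _ lG) GGx scalerBr scalerA -rmorphM -expr2 addrA subrK subrr.
  exact: rdot0l.
rewrite rdotDl rdotZl -nrm2 => h; have := psd_rdot_ge0 z pG.
have /eqP : nrm z ^+ 2 = 0.
  apply/le_anti; rewrite sqr_ge0 andbT -(pmulr_rle0 _ l0).
  by have := psd_rdot_ge0 z pG; lra.
by rewrite sqrf_eq0 nrm_eq0 subr_eq0 => /eqP.
Qed.

Lemma schatten_sumE p T (e : nat -> H) : 0 < p -> bounded_op T -> compact_op T -> greedy T e ->
  schatten_sum p T = (\esum_(k in setT) (nrm (T (e k)) `^ p)%:E)%E.
Proof.
move=> p0 bT cT gT; rewrite -(esum_singular_values p0 bT cT gT).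
by apply: eq_esum => l l0; rewrite eigspace_abs.
Qed.

(** An ultrafilter on the closure of the image of the unit ball under D is
    Cauchy: if it contained no ball of radius d, one could choose inductively
    points of the unit ball with separated images. *)
Lemma compact_op_le B D : compact_op B -> linear B -> linear D ->
  (forall x, nrm (D x) <= nrm (B x)) -> compact_op D.
Proof.
move=> cB lB lD DB; rewrite /compact_op compact_ultra => F FU FK.
set ball1 := [set x : H | `|x| <= 1] in FK *; set K := closure _ in FK *.
have b1 x : ball1 x <-> nrm x <= 1.
  by rewrite /ball1 /= norm_nrm -(rmorph1 (real_complex R)) lecR.
have /cauchy_cvg Fcvg : cauchy F.
  apply: cauchy_exP => c c0; have [d0 ->] := gt0_ReE c0; set d := complex.Re c in d0 *.
  apply: contrapT => noball.
  have far (l : seq H) : exists z, ball1 z /\ forall y, y \in l -> d / 2 <= nrm (D z - D y).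
    have Fl : F [set k | forall y, y \in l -> d <= nrm (D y - k)].
      elim: l => [|y l IH]; first by apply: filterE.
      have Fy : F (~` ball (D y) d%:C).
        case: (in_ultra_setVsetC (ball (D y) d%:C) FU) => // h.
        by case: noball; exists (D y).
      apply: filterS2 Fy IH => k ky kl z; rewrite inE => /predU1P[->|/kl//].
      by rewrite leNgt; apply/negP => h; apply: ky; apply/ball_nrm.
    have [k [kl Kk]] := filter_ex (filterI Fl FK).
    have d20 : 0 < d / 2 by rewrite divr_gt0.
    have /closure_nrmP/(_ _ d20)[_ [z bz <-] kz] := Kk.
    exists z; split=> // y yl; have := kl y yl.
    have := ler_nrmD (D y - D z) (D z - k).
    by rewrite subrKA [nrm (D y - _)]nrmB [nrm (D z - k)]nrmB; lra.
  have [g gP] := choice far.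
  pose pre := fix pre n := if n is m.+1 then g (pre m) :: pre m else [::].
  have mem i n : (i < n)%N -> g (pre i) \in pre n.
    elim: n => // n IH; rewrite ltnS leq_eqVlt inE => /predU1P[->|/IH ->].
      by rewrite eqxx.
    by rewrite orbT.
  have u1 n : nrm (g (pre n)) <= 1 by apply/b1; exact: (gP _).1.
  have d20 : 0 < d / 2 by rewrite divr_gt0.
  have [i [j [ij]]] := compact_op_separated cB lB lD DB d20 u1.
  by rewrite ltNge (gP (pre j)).2// mem.
exists (lim F); split=> // A nA.
have [k [Kk Ak]] := filter_ex (filterI FK (Fcvg _ (nbhs_interior nA))).
by have [y [Dy Ay]] := Kk A Ak; exists y.
Qed.

Lemma esum_le_eq (I : choiceType) (a b : I -> R) :
  (forall i, 0 <= a i) -> (forall i, a i <= b i) ->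
  (\esum_(i in setT) (b i)%:E < +oo)%E ->
  (\esum_(i in setT) (a i)%:E = \esum_(i in setT) (b i)%:E)%E -> forall i, a i = b i.
Proof.
move=> a0 ab bfin eqab i.
have E : (\esum_(i in setT) (b i)%:E =
   \esum_(i in setT) (a i)%:E + \esum_(i in setT) (b i - a i)%:E)%E.
  rewrite -esumD => [|j _|j _]; rewrite ?lee_fin ?subr_ge0//.
  by apply: eq_esum => j _; rewrite -EFinD addrCA subrr addr0.
have bf : (\esum_(i in setT) (b i)%:E)%E \is a fin_num.
  by rewrite ge0_fin_numE// esum_ge0// => j _; rewrite lee_fin (le_trans (a0 j)).
have z : (\esum_(i in setT) (b i - a i)%:E = 0)%E.
  by move: E; rewrite eqab => /(congr1 (fun s => s - \esum_(i in setT) (b i)%:E)%E); rewrite addeAC subee// add0e => <-.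
suff : ((b i - a i)%:E <= 0)%E.
  by rewrite lee_fin subr_le0 => ba; apply/le_anti; rewrite ab.
rewrite -z.
by apply: esum_ge; exists [set i]; [split|rewrite fsbig_set1].
Qed.

(** Weyl monotonicity with its equality case: the singular values of D are at
    most those of B, and if the sums agree then so do all singular values, which
    by greedy_transfer identifies the two quadratic forms. *)
Lemma schatten_sum_le p B D : 0 < p -> bounded_op D -> schatten_class p B ->
  (forall x, nrm (D x) <= nrm (B x)) ->
  [/\ schatten_class p D, (schatten_sum p D <= schatten_sum p B)%E &
      schatten_sum p D = schatten_sum p B -> forall x, nrm (D x) = nrm (B x)].
Proof.
move=> p0 bD [bB cB Bfin] DB; have lB := bB.1; have lD := bD.1.
have cD := compact_op_le cB lB lD DB.
have [e ge] := greedy_exists bB cB; have [f gf] := greedy_exists bD cD.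
have DBs := greedy_le lB lD ge gf DB.
have le k : nrm (D (f k)) `^ p <= nrm (B (e k)) `^ p.
  by rewrite ge0_ler_powR ?nnegrE ?nrm_ge0 ?(ltW p0).
have les : (schatten_sum p D <= schatten_sum p B)%E.
  rewrite (schatten_sumE p0 bB cB ge) (schatten_sumE p0 bD cD gf).
  by apply: le_esum => k _; rewrite lee_fin.
split=> //; first by split=> //; exact: le_lt_trans les Bfin.
rewrite (schatten_sumE p0 bB cB ge) in Bfin *; rewrite (schatten_sumE p0 bD cD gf).
move=> /(esum_le_eq (fun k => powR_ge0 _ _) le Bfin) eqp.
have eqs k : nrm (D (f k)) = nrm (B (e k)).
  by apply: (powR_injective p0); rewrite ?nnegrE ?nrm_ge0//; exact: eqp.
have [gBf Bf] := greedy_transfer bB cB lD ge gf DB eqs.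
by move=> x; rewrite -(greedy_nrm_eq bB cB bD gBf gf Bf).
Qed.

Lemma schatten_norm_le p B D : 0 < p -> bounded_op D -> schatten_class p B ->
  (forall x, nrm (D x) <= nrm (B x)) ->
  [/\ schatten_class p D, (schatten_norm p D <= schatten_norm p B)%E &
      schatten_norm p D = schatten_norm p B -> forall x, nrm (D x) = nrm (B x)].
Proof.
move=> p0 bD sB DB; have [sD le eq] := schatten_sum_le p0 bD sB DB.
have s0 T : (0 <= schatten_sum p T)%E.
  apply: esum_ge0 => l _; rewrite mule_ge0 ?lee_fin ?powR_ge0//.
  apply: ereal_sup_ubound; exists 0%N => //; exists (fun i => 0).
  by split=> [c _ []//|[]//].
rewrite /schatten_norm !asboolT//; split=> //.
  rewrite gt0_ler_poweR ?invr_ge0 ?(ltW p0)//; rewrite in_itv /= s0 leey//.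
move=> h; apply: eq.
have := congr1 (fun s => poweR s p) h.
by rewrite -!poweRrM mulVf ?gt_eqF// !poweRe1.
Qed.
End SchattenMonotone.

(** * Closed ranges and orthogonal projectors *)

Section ClosedRange.
Variables (R : realType) (H : hilbertType R[i]).
Implicit Types (x y z : H) (a b t p : R) (A B C D Q T W X : H -> H).

Lemma bounded_id : bounded_op (@idfun H).
Proof. by apply/bounded_nrmP; split=> //; exists 1 => // x; rewrite mul1r. Qed.

Lemma bounded_cst0 : bounded_op (cst 0 : H -> H).
Proof.
apply/bounded_nrmP; split=> [c x y|]; first by rewrite scaler0 addr0.
by exists 0 => // x; rewrite nrm0 mul0r.
Qed.

Lemma bounded_add S T : bounded_op S -> bounded_op T -> bounded_op (S \+ T).
Proof.
move=> /bounded_nrmP[lS [M M0 SM]] /bounded_nrmP[lT [N N0 TN]].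
apply/bounded_nrmP; split=> [c x y /=|].
  by rewrite lT lS scalerDr addrACA.
exists (M + N) => [|x /=]; first exact: addr_ge0.
by rewrite mulrDl (le_trans (ler_nrmD _ _))// lerD.
Qed.

Lemma bounded_sub S T : bounded_op S -> bounded_op T -> bounded_op (S \- T).
Proof.
move=> bS /bounded_nrmP[lT [N N0 TN]]; apply: (bounded_add bS).
apply/bounded_nrmP; split=> [c x y /=|].
  by rewrite lT opprD scalerN.
by exists N => // x /=; rewrite nrmN.
Qed.

Lemma range_subspace A : linear A -> is_subspace (range A).
Proof.
move=> lA; split; first by exists 0 => //; exact: lin0.
by move=> c _ _ [x _ <-] [y _ <-]; exists (c *: x + y) => //; rewrite lA.
Qed.

Lemma bounded_below_closed_image T (S : set H) M : bounded_op T -> closed S ->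
  is_subspace S -> (forall s, S s -> nrm s <= M * nrm (T s)) -> closed (T @` S).
Proof.
move=> /bounded_nrmP[lT [N N0 TN]] cS sS TM x /closure_nrmP cx.
have [e e0|e e' ee' s [Ss se]|d d0|s0 s0P] :=
    @complete_family _ H (fun e => [set s | S s /\ nrm (x - T s) < e]).
- by have [_ [s Ss <-] xs] := cx e e0; exists s.
- by split=> //; exact: lt_le_trans ee'.
- have M1 : 0 < 2 * `|M| + 1 by have := normr_ge0 M; lra.
  exists (d / (2 * `|M| + 1)) => [|s s' [Ss se] [Ss' se']]; first exact: divr_gt0.
  apply: le_lt_trans (TM _ (subspaceB sS Ss Ss')) _; rewrite linB//.
  have := ler_nrmB (x - T s') (x - T s).
  have -> : x - T s' - (x - T s) = T s - T s' by rewrite opprB addrC addrA subrK.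
  move: se se'; set e := d / _ => se se' h.
  have ed : e * (2 * `|M| + 1) = d by rewrite /e divfK// gt_eqF.
  have h1 := ler_wpM2r (nrm_ge0 (T s - T s')) (ler_norm M).
  have e0 : 0 < e by rewrite divr_gt0.
  have h2 : `|M| * nrm (T s - T s') <= `|M| * (e + e).
    by rewrite ler_wpM2l//; lra.
  by lra.
have Ss0 : S s0.
  apply: cS => B nB; have [s [[Ss _] Bs]] := s0P 1 ltr01 B nB; by exists s.
exists s0 => //; apply/eqP; rewrite eq_sym -subr_eq0 -nrm_eq0; apply/eqP/le_anti.
rewrite nrm_ge0 andbT; apply/ler_addgt0Pr => e e0; rewrite add0r.
have N1 : 0 < N + 1 by lra.
have d0 : 0 < e / (N + 1) / 2 by rewrite !divr_gt0.
have [s [Ss xs] ss] := (closure_nrmP _ _).1 (s0P _ d0) _ d0.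
have := ler_nrmD (x - T s) (T s - T s0); rewrite subrKA.
have := TN (s - s0); rewrite linB// [nrm (s - s0)]nrmB.
move: xs ss; set d := e / (N + 1) / 2 => xs ss h1 h2.
have ed : d * (N + 1) = e / 2 by rewrite /d mulrAC divfK// gt_eqF.
have : N * nrm (s0 - s) <= N * d by rewrite ler_wpM2l// ltW.
by lra.
Qed.

(** Uniform boundedness of the s in range A with nrm (adjoint A s) <= 1: by
    projection on range A, any y may be replaced by some A x, and
    '[A x, s] = '[x, adjoint A s]. *)
Lemma adjoint_bounded_below A : bounded_op A -> closed (range A) ->
  exists M, 0 <= M /\ forall s, range A s -> nrm s <= M * nrm (adjoint A s).
Proof.
move=> bA cA; have [lA _] := bA; have sA := range_subspace lA.
have [[lAs _] Aadj] := adjointP bA.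
have [y|M MP] := @uniform_boundedness _ H [set s | range A s /\ nrm (adjoint A s) <= 1].
  have [_ [x _ <-] o] := projection y sA cA.
  exists (nrm x) => s [As s1]; have := o s As; rewrite hdotBl => /eqP.
  rewrite subr_eq0 /rdot => /eqP ->; rewrite Aadj; apply: le_trans (rdot_CS _ _) _.
  by rewrite -[leRHS]mulr1 ler_wpM2l ?nrm_ge0.
exists `|M|; split=> // s As; have [a0|a_neq0] := eqVneq (nrm (adjoint A s)) 0.
  have [x _ xs] := As; suff -> : s = 0 by rewrite nrm0 mulr_ge0 ?nrm_ge0.
  apply/eqP; rewrite -(dnorm_eq0 hdot) -{1}xs Aadj; apply/eqP.
  by move/eqP: a0; rewrite nrm_eq0 => /eqP ->; rewrite linear0r.
have a0 : 0 < nrm (adjoint A s) by rewrite lt_def a_neq0 nrm_ge0.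
have := MP ((nrm (adjoint A s))^-1%:C *: s) _.
rewrite nrmZ ger0_norm ?invr_ge0 ?nrm_ge0// ler_pdivrMl//.
have h1 := ler_wpM2r (nrm_ge0 (adjoint A s)) (ler_norm M).
move=> h; rewrite mulrC in h; apply: le_trans (h _) h1.
split; first exact: subspaceZ.
by rewrite linZ// nrmZ ger0_norm ?invr_ge0 ?nrm_ge0// mulVf.
Qed.

(** The preimage of Q x is looked for in the image L of range A under the adjoint
    of A. L is closed because the adjoint is bounded below on range A; the
    component of a preimage orthogonal to L is killed by A, and A is injective on
    L. The lower bound also bounds the solution. *)
Lemma right_factor A Q : bounded_op A -> closed (range A) -> bounded_op Q ->
  range Q `<=` range A -> exists X, bounded_op X /\ forall x, A (X x) = Q x.
Proof.
move=> bA cA bQ QA; have [lA _] := bA; have sA := range_subspace lA.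
have [bAs Aadj] := adjointP bA; have [lAs _] := bAs; set As := adjoint A in bAs Aadj lAs *.
have [M [M0 AsM]] := adjoint_bounded_below bA cA.
have cL := bounded_below_closed_image bAs cA sA AsM.
have sL : is_subspace (As @` range A).
  split; first by exists 0; [exact: sA.1|exact: lin0].
  move=> c _ _ [x Ax <-] [y Ay <-]; exists (c *: x + y); first exact: sA.2.
  exact: lAs.
have solve x : exists s, range A s /\ A (As s) = Q x.
  have [y _ yQ] := QA (Q x) (imageT _ _).
  have [_ [s sR <-] o] := projection y sL cL; exists s; split=> //.
  apply/eqP; rewrite -yQ eq_sym -subr_eq0 -linB// -(dnorm_eq0 hdot) Aadj; apply/eqP.
  by apply: o; exists (A (y - As s)) => //; exists (y - As s).
have [g gP] := choice solve.
have AsAs s : '[As s, As s] = '[A (As s), s] by rewrite Aadj.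
exists (fun x => As (g x)); split; last by move=> x; exact: (gP x).2.
have /bounded_nrmP[lQ [N N0 QN]] := bQ.
apply/bounded_nrmP; split=> [c x y|].
  apply/eqP; rewrite -subr_eq0 -lAs -linB// -(dnorm_eq0 hdot) AsAs.
  rewrite linB// linB// !lAs lA !(gP _).2 lQ subrr; apply/eqP; exact: linear0l.
exists (M * N) => [|x]; first exact: mulr_ge0.
have [->|a_neq0] := eqVneq (nrm (As (g x))) 0; first by rewrite !mulr_ge0 ?nrm_ge0.
have a0 : 0 < nrm (As (g x)) by rewrite lt_def a_neq0 nrm_ge0.
rewrite -(ler_pM2r a0) -expr2 nrm2 {1}/rdot AsAs (gP x).2.
apply: le_trans (rdot_le (Q x) (g x)) _.
have h1 := ler_wpM2l (nrm_ge0 (Q x)) (AsM (g x) (gP x).1).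
have h2 := ler_wpM2r (mulr_ge0 M0 (ltW a0)) (QN x).
by rewrite -/As in h1; lra.
Qed.

Lemma orth_projector (N : set H) : is_subspace N -> closed N ->
  exists P : H -> H, [/\ bounded_op P, forall x, N (P x) & forall x, N x -> P x = x].
Proof.
move=> sN cN.
have ex x : exists v, N v /\ forall w, N w -> '[x - v, w] = 0.
  by have [v Nv o] := projection x sN cN; exists v.
have [P PP] := choice ex.
have uniq x v : N v -> (forall w, N w -> '[x - v, w] = 0) -> P x = v.
  move=> Nv o; have Nd := subspaceB sN (PP x).1 Nv.
  apply/eqP; rewrite -subr_eq0 -(dnorm_eq0 hdot); apply/eqP.
  have {1}-> : P x - v = (x - v) - (x - P x) by rewrite opprB [RHS]addrC subrKA.
  by rewrite hdotBl o// (PP x).2// subrr.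
exists P; split=> [|x|x Nx]; last 2 first.
- exact: (PP x).1.
- by apply: uniq => // w _; rewrite subrr linear0l.
apply/bounded_nrmP; split=> [c x y|].
  apply: uniq => [|w Nw]; first by apply: sN.2; exact: (PP _).1.
  have -> : c *: x + y - (c *: P x + P y) = c *: (x - P x) + (y - P y).
    by rewrite scalerBr opprD addrACA.
  by rewrite hdotDl hdotZl !(PP _).2// mulr0 addr0.
exists 1 => // x; rewrite mul1r -(@ler_pXn2r _ 2) ?nnegrE ?nrm_ge0//.
rewrite -[x in leRHS](subrK (P x)) [leRHS]nrmD2 rdot_hdot0 ?(PP x).2//; last exact: (PP x).1.
by have := sqr_ge0 (nrm (x - P x)); lra.
Qed.
End ClosedRange.

(** * Weighted least squares and the shorted operator *)

Section WeightedLeastSquares.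
Variables (R : realType) (H : hilbertType R[i]).
Implicit Types (x y z : H) (a b t p : R) (A B C D Q T W X : H -> H).

Definition resid W A X : H -> H := sqrt_op W \o (A \o X \- idfun).

Lemma resid_bounded W A X : psd_op W -> bounded_op A -> bounded_op X ->
  bounded_op (resid W A X).
Proof.
move=> pW bA bX; apply: bounded_comp; first exact: (sqrt_opP pW).1.1.
by apply: bounded_sub; [exact: bounded_comp|exact: bounded_id].
Qed.

Lemma hdot_sqrt W x y : psd_op W -> '[sqrt_op W x, sqrt_op W y] = '[W x, y].
Proof.
by move=> pW; have [pC CC] := sqrt_opP pW; rewrite -psd_sym// CC.
Qed.

Lemma W_seminormE W x : psd_op W -> W_seminorm W x = (nrm (sqrt_op W x))%:C.
Proof.
move=> pW; rewrite /W_seminorm -hdot_sqrt// hdot_self.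
by rewrite (rmorphXn (real_complex R)) sqrCK// lecR nrm_ge0.
Qed.

Lemma W_inverse_leP W A X : psd_op W -> bounded_op X ->
  W_inverse W A X <-> forall x z, nrm (resid W A X x) <= nrm (sqrt_op W (A z - x)).
Proof.
move=> pW bX; split=> [[_ h] x z|h]; first by have := h x z; rewrite !W_seminormE// lecR.
by split=> // x z; rewrite !W_seminormE// lecR; exact: h.
Qed.

(** The normal equations of the least squares problem. *)
Lemma W_inverse_orthP W A X : psd_op W -> bounded_op A -> bounded_op X ->
  W_inverse W A X <-> forall x z, '[resid W A X x, sqrt_op W (A z)] = 0.
Proof.
move=> pW bA bX; have [pC CC] := sqrt_opP pW; have [[lC _] _] := pC.
have lA := bA.1; rewrite W_inverse_leP//.
have shift x z : sqrt_op W (A z - x) = resid W A X x + sqrt_op W (A (z - X x)).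
  by rewrite /resid /= -(linD _ _ lC) (linB _ _ lA) [in RHS]addrC subrKA.
split=> h x z; last first.
  rewrite -(@ler_pXn2r _ 2) ?nnegrE ?nrm_ge0// shift nrmD2 rdot_hdot0 ?h//.
  by have := sqr_ge0 (nrm (sqrt_op W (A (z - X x)))); lra.
have real w : rdot (resid W A X x) (sqrt_op W (A w)) = 0.
  apply: (@quad_ge0_lin0 _ _ (nrm (sqrt_op W (A w)) ^+ 2)) => t.
  have := h x (X x + t%:C *: w); rewrite shift (addrC (X x)) addrK (linZ _ _ lA) (linZ _ _ lC).
  rewrite -(@ler_pXn2r _ 2) ?nnegrE ?nrm_ge0// nrmD2 rdotZr nrmZ exprMn.
  by rewrite real_normK ?num_real//; lra.
by rewrite hdotE -(linZ _ _ lC) -(linZ _ _ lA) !real.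
Qed.

(** If the residual T violates the normal equations in the direction
    w = sqrt W (A z), then T can be composed with the orthogonal projection along w:
    this subtracts multiples of w only, so it amounts to a rank one change of X. *)
Lemma resid_improve W A X x0 z : psd_op W -> bounded_op A -> bounded_op X ->
  '[resid W A X x0, sqrt_op W (A z)] != 0 ->
  exists X1, [/\ bounded_op X1, forall x, nrm (resid W A X1 x) <= nrm (resid W A X x) &
                 nrm (resid W A X1 x0) < nrm (resid W A X x0)].
Proof.
move=> pW bA bX nz; have [pC CC] := sqrt_opP pW; have [[lC _] _] := pC.
have lA := bA.1; have /bounded_nrmP[lX [N N0 XN]] := bX.
have bT := resid_bounded pW bA bX; have /bounded_nrmP[lT [M M0 TM]] := bT.
set T := resid W A X in nz bT lT TM *; set w := sqrt_op W (A z) in nz *.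
have w0 : 0 < nrm w by rewrite nrm_gt0; apply: contraNneq nz => ->; rewrite linear0r.
pose r : R := (nrm w ^+ 2)^-1.
have r0 : 0 < r by rewrite invr_gt0 exprn_gt0.
pose X1 x := X x - r%:C *: ('[T x, w] *: z).
have T1 x : resid W A X1 x = T x - r%:C *: ('[T x, w] *: w).
  rewrite /resid /T /resid /= /X1 (linB _ _ lA) !(linZ _ _ lA) addrAC.
  by rewrite (linB _ _ lC) !(linZ _ _ lC).
have T1w x : '[resid W A X1 x, w] = 0.
  rewrite T1 hdotBl !hdotZl hdot_self mulrCA -rmorphM /r mulVf ?mulr1 ?subrr//.
  by rewrite sqrf_eq0 gt_eqF.
have pyth x : nrm (T x) ^+ 2 =
    nrm (resid W A X1 x) ^+ 2 + nrm (r%:C *: ('[T x, w] *: w)) ^+ 2.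
  have {1}-> : T x = resid W A X1 x + r%:C *: ('[T x, w] *: w) by rewrite T1 subrK.
  by rewrite nrmD2 rdotZr rdot_hdot0 ?mulr0 ?addr0// hdotZr T1w mulr0.
exists X1; split=> [|x|].
- apply/bounded_nrmP; split=> [c x y|].
    rewrite /X1 lX lT hdotDl hdotZl scalerDl scalerDr opprD addrACA scalerBr.
    by congr (_ - _ + _); rewrite !scalerA mulrCA !mulrA.
  exists (N + r * (M * nrm w * nrm z)) => [|x].
    by rewrite addr_ge0// mulr_ge0 ?(ltW r0)// !mulr_ge0 ?nrm_ge0.
  apply: le_trans (ler_nrmB _ _) _; rewrite mulrDl lerD//.
  rewrite nrmZ ger0_norm ?(ltW r0)// nrmZC -!mulrA ler_wpM2l ?(ltW r0)//.
  apply: le_trans (ler_wpM2r (nrm_ge0 z) (nrm_CS_hdot (T x) w)) _.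
  have := ler_wpM2r (mulr_ge0 (nrm_ge0 w) (nrm_ge0 z)) (TM x).
  by lra.
- rewrite -(@ler_pXn2r _ 2) ?nnegrE ?nrm_ge0// pyth lerDl; exact: sqr_ge0.
rewrite -(@ltr_pXn2r _ 2) ?nnegrE ?nrm_ge0// pyth ltrDl exprn_gt0// nrm_gt0.
rewrite !scaler_eq0 !negb_or nz -nrm_gt0 w0 andbT.
by rewrite eq_complex /= eqxx andbT gt_eqF.
Qed.

(** If Q is a W-selfadjoint projection on range A, any X with A X = Q is a
    W-inverse. *)
Lemma compatible_W_inverse W A : psd_op W -> bounded_op A -> closed (range A) ->
  compatible W (range A) -> exists X, W_inverse W A X.
Proof.
move=> pW bA cA [Q [bQ QQ rQ WQ]].
have [X [bX AX]] : exists X, bounded_op X /\ forall x, A (X x) = Q x.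
  by apply: right_factor => //; rewrite rQ.
exists X; apply/W_inverse_orthP => // x z.
have [y _ Qy] : range Q (A z) by rewrite rQ; exists z.
have [_ Qadj] := adjointP bQ.
have WQE u : W (Q u) = adjoint Q (W u) := congr1 (fun f => f u) WQ.
have QQE u : Q (Q u) = Q u := congr1 (fun f => f u) QQ.
rewrite /resid /= hdot_sqrt// -Qy AX psd_sym// WQE -Qadj.
by rewrite linB ?QQE ?subrr ?linear0l//; exact: bQ.1.
Qed.

(** The normal equations say that A X is W-selfadjoint and, on range A, the
    identity up to the null space N of W in range A. *)
Lemma W_inverse_compatible W A X : psd_op W -> bounded_op A -> closed (range A) ->
  W_inverse W A X -> compatible W (range A).
Proof.
move=> pW bA cA hX; have bX := hX.1; have lA := bA.1; have sA := range_subspace lA.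
have [pC CC] := sqrt_opP pW; have [[lC _] _] := pC; have [[lW _] _] := pW.
have orth := (W_inverse_orthP pW bA bX).1 hX.
pose E := A \o X; have bE : bounded_op E by exact: bounded_comp.
have lE := bE.1.
have rE x : range A (E x) by exists (X x).
have normal x s : range A s -> '[W (E x - x), s] = 0.
  by move=> [z _ <-]; rewrite -hdot_sqrt//; exact: orth.
(* Let P be the orthogonal projection on N; then
   P + (1 - P) A X (1 - P) is the identity on range A, and W does not see the
   difference with A X. *)
pose N : set H := [set n | range A n /\ W n = 0].
have sN : is_subspace N.
  split=> [|c x y [Ax Wx] [Ay Wy]]; first by split; [exact: sA.1|exact: lin0].
  by split; [exact: sA.2|rewrite lW Wx Wy scaler0 addr0].
have cN : closed N.
  have -> : N = range A `&` [set n | forall y, (range W) y -> '[n, y] = 0].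
    apply/seteqP; split=> n [An h]; split=> //.
      by move=> _ [y _ <-]; rewrite -psd_sym// h linear0l.
    by apply: hdot_ext => y; rewrite linear0r -psd_sym// hdot0C//; apply: h; exists y.
  by apply: closedI => //; exact: closed_orth.
have [P [bP NP PN]] := orth_projector sN cN; have lP := bP.1.
have PP x : P (P x) = P x by exact: PN.
pose I' := @idfun H \- P.
have bI' : bounded_op I' by apply: bounded_sub => //; exact: bounded_id.
pose Q := P \+ (I' \o E \o I').
have bQ : bounded_op Q by apply: bounded_add => //; do 2?apply: bounded_comp.
have EN u : range A u -> N (E u - u).
  move=> Au; have Ad := subspaceB sA (rE u) Au; split=> //.
  have := normal u _ Ad; rewrite -hdot_sqrt// => /eqP; rewrite dnorm_eq0 => /eqP h.
  by rewrite -CC h lin0.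
have QS s : range A s -> Q s = s.
  move=> As; rewrite /Q /I' /=; set u := s - P s.
  have Au : range A u by apply: subspaceB => //; exact: (NP s).1.
  have Pu : P u = 0 by rewrite /u linB// PP subrr.
  have := PN _ (EN u Au); rewrite linB// Pu subr0 => ->.
  by rewrite opprB [E u + _]addrC subrK /u addrC subrK.
have rQ x : range A (Q x).
  apply: subspaceD => //; first exact: (NP x).1.
  by apply: subspaceB => //; exact: (NP _).1.
have WQ x : W (Q x) = W (E x).
  rewrite /Q /I' /= linD// !(linB _ _ lW) !(NP _).2 subr0 add0r linB// linB//.
  have := (EN (P x) (NP x).1).2; rewrite linB// (NP x).2 subr0 => ->.
  by rewrite subr0.
exists Q; split=> //.
- by apply/funext => x /=; exact: QS.
- apply/seteqP; split=> [_ [x _ <-]//|s As]; by exists s => //; exact: QS.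
have [_ Qadj] := adjointP bQ.
have symWE x y : '[y, W (E x)] = '[W (E y), x].
  have /eqP := normal y _ (rE x); rewrite linB// hdotBl subr_eq0 => /eqP h1.
  have /hdot0C/eqP := normal x _ (rE y); rewrite linB// hdotBr subr_eq0 => /eqP h2.
  by rewrite -(psd_sym pW) -h1 (psd_sym pW) h2 (psd_sym pW).
apply/funext => x /=; apply: hdot_ext => y.
by rewrite -Qadj WQ symWE -WQ psd_sym.
Qed.

Lemma op_le_anti X Y : op_le X Y -> op_le Y X -> X = Y.
Proof.
move=> h1 h2; have [b1 s1 _] := (psdP _).1 h1.
have z x : rdot ((Y \- X) x) x = 0.
  apply/le_anti; rewrite psd_rdot_ge0// andbT -oppr_ge0 -rdotNl /= opprB.
  exact: psd_rdot_ge0 h2.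
apply/funext => x; apply/eqP; rewrite eq_sym -subr_eq0 -nrm_eq0 -sqrf_eq0.
have [[l1 _] _] := h1; set D := Y \- X in b1 s1 z l1 *.
rewrite -[Y x - X x]/(D x) nrm2; apply/eqP.
clearbody D; apply: (@quad_ge0_lin0 _ _ 0) => t.
have := z (x + t%:C *: D x); rewrite (linD _ _ l1) (linZ _ _ l1) !rdotDl !rdotDr.
rewrite !rdotZl !rdotZr !z (_ : rdot (D (D x)) x = rdot (D x) (D x)); last by rewrite /rdot s1.
by lra.
Qed.

(** Let T be the residual of a W-inverse X. A candidate Y vanishes on range A,
    so its quadratic form at x is the one at v = A (X x) - x, hence at most that of
    W at v, which is the squared norm of T x. Conversely T* T is a candidate, since
    T vanishes on range A. *)
Lemma shortedE W A X : psd_op W -> bounded_op A -> W_inverse W A X ->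
  shorted W (range A) = adjoint (resid W A X) \o resid W A X.
Proof.
move=> pW bA hX; have bX := hX.1; have bT := resid_bounded pW bA bX.
have [pC CC] := sqrt_opP pW; have [[lC _] _] := pC.
have le := (W_inverse_leP A pW bX).1 hX.
have orth := (W_inverse_orthP pW bA bX).1 hX.
have lA := bA.1; have lT := bT.1; set T := resid W A X in bT lT le orth *.
have [bTs Tadj] := adjointP bT; set Z := adjoint T \o T.
have bZ : bounded_op Z by exact: bounded_comp.
have ZT x y : '[Z x, y] = '[T x, T y] by rewrite /Z /= hdotC -Tadj -hdotC.
have ZTr x : rdot (Z x) x = nrm (T x) ^+ 2 by rewrite nrm2 /rdot ZT.
have symZ x y : '[Z x, y] = '[x, Z y] by rewrite ZT hdotC -ZT -hdotC.
have bW := pW.1.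
have TC x : nrm (T x) <= nrm (sqrt_op W x).
  by have := le x 0; rewrite (lin0 lA) sub0r (linN _ lC) nrmN.
have TA z : T (A z) = 0.
  apply/eqP; rewrite -nrm_eq0; apply/eqP/le_anti; rewrite nrm_ge0 andbT.
  by have := le (A z) z; rewrite subrr (lin0 lC) nrm0.
have Wnrm x : rdot (W x) x = nrm (sqrt_op W x) ^+ 2.
  by rewrite nrm2 /rdot hdot_sqrt.
have candZ : shorted_candidates W (range A) Z.
  split=> //.
  - apply/psdP; split=> [|x y|x].
    + by apply: bounded_sub => //; exact: bounded_cst0.
    + by rewrite /= !subr0.
    + by rewrite /= subr0 ZTr sqr_ge0.
  - apply/psdP; split=> [|x y|x]; first exact: bounded_sub.
    + by rewrite hdotBl hdotBr symZ psd_sym.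
    + by rewrite rdotBl ZTr Wnrm subr_ge0 ler_pXn2r ?nnegrE ?nrm_ge0.
  - by move=> _ [x _ <-] _ [z _ <-]; rewrite ZT TA linear0r.
have maxZ Y : shorted_candidates W (range A) Y -> op_le Y Z.
  move=> [bY Y0 YW Yr]; have lY := bY.1.
  have symY x y : '[Y x, y] = '[x, Y y].
    by have := psd_sym Y0 x y; rewrite /= !subr0.
  apply/psdP; split=> [|x y|x]; first exact: bounded_sub.
    by rewrite hdotBl hdotBr symZ symY.
  rewrite rdotBl ZTr subr_ge0.
  set v := A (X x) - x.
  have YA z y : '[Y y, A z] = 0 by apply: Yr; [exists y|exists z].
  have -> : rdot (Y x) x = rdot (Y v) v.
    rewrite /v linB// rdotBl !rdotBr.
    rewrite (rdot_hdot0 (YA _ (A (X x)))) (rdot_hdot0 (YA _ x)).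
    rewrite (@rdot_hdot0 _ _ (Y (A (X x))) x); last by rewrite symY; exact/hdot0C/YA.
    by ring.
  have -> : nrm (T x) ^+ 2 = rdot (W v) v by rewrite Wnrm.
  by rewrite -subr_ge0 -rdotBl; exact: psd_rdot_ge0 YW.
by apply: xget_unique => // Y [cY maxY]; apply: op_le_anti; [exact: maxZ|exact: maxY].
Qed.

Lemma schatten_norm_eq p B D : 0 < p -> bounded_op D -> schatten_class p B ->
  (forall x, nrm (D x) = nrm (B x)) -> schatten_norm p D = schatten_norm p B.
Proof.
move=> p0 bD sB DB.
have DB1 x : nrm (D x) <= nrm (B x) by rewrite DB.
have DB2 x : nrm (B x) <= nrm (D x) by rewrite DB.
have [sD le1 _] := schatten_norm_le p0 bD sB DB1; have [bB _ _] := sB.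
have [_ le2 _] := schatten_norm_le p0 bB sD DB2.
by apply/le_anti; rewrite le1 le2.
Qed.

Lemma schatten_norm_resid p W A X : 0 < p -> psd_op W -> bounded_op A ->
  W_inverse W A X -> schatten_class p (sqrt_op W) ->
  schatten_class p (resid W A X) /\
  schatten_norm p (sqrt_op (shorted W (range A))) = schatten_norm p (resid W A X).
Proof.
move=> p0 pW bA hX sW; have bX := hX.1; have bT := resid_bounded pW bA bX.
have [pC CC] := sqrt_opP pW; have [[lC _] _] := pC.
have TC x : nrm (resid W A X x) <= nrm (sqrt_op W x).
  have := (W_inverse_leP A pW bX).1 hX x 0.
  by rewrite (lin0 bA.1) sub0r (linN _ lC) nrmN.
have [sT _ _] := schatten_norm_le p0 bT sW TC; split=> //.
rewrite (shortedE pW bA hX); have [bTs Tadj] := adjointP bT.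
have pZ : psd_op (adjoint (resid W A X) \o resid W A X).
  split=> [|x /=]; first exact: bounded_comp.
  by rewrite hdotC -Tadj -hdotC; exact: dnorm_ge0.
have [pG GG] := sqrt_opP pZ; apply: schatten_norm_eq => // [|x]; first exact: pG.1.
apply/eqP; rewrite -(@eqrXn2 _ 2) ?nrm_ge0// !nrm2 /rdot -psd_sym// GG /=.
by rewrite hdotC -Tadj -hdotC.
Qed.

(** The norm at X = 0 is finite, so the residual of a minimizer is in the
    Schatten class; by resid_improve and the equality case of schatten_norm_le it
    satisfies the normal equations. *)
Lemma minimizer_W_inverse p W A X : 0 < p -> psd_op W -> bounded_op A -> bounded_op X ->
  schatten_class p (sqrt_op W) ->
  (forall Y, bounded_op Y ->
     (schatten_norm p (resid W A X) <= schatten_norm p (resid W A Y))%E) ->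
  W_inverse W A X.
Proof.
move=> p0 pW bA bX sW Xmin; have [pC CC] := sqrt_opP pW; have [[lC _] _] := pC.
have sT : schatten_class p (resid W A X).
  apply: contrapT => nsT; have := Xmin _ (bounded_cst0 H).
  have le0 x : nrm (resid W A (cst 0) x) <= nrm (sqrt_op W x).
    by rewrite /resid /= (lin0 bA.1) sub0r (linN _ lC) nrmN.
  have [s0 _ _] := schatten_norm_le p0 (resid_bounded pW bA (bounded_cst0 H)) sW le0.
  rewrite {1}/schatten_norm asboolF// leye_eq.
  rewrite /schatten_norm asboolT// => /eqP /poweR_eqy h.
  by have [_ _] := s0; rewrite h ltxx.
apply/W_inverse_orthP => // x z; apply/eqP/negPn/negP => nz.
have [X1 [bX1 le lt]] := resid_improve pW bA bX nz.
have [_ le1 eq1] := schatten_norm_le p0 (resid_bounded pW bA bX1) sT le.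
have /eq1/(_ x) : schatten_norm p (resid W A X1) = schatten_norm p (resid W A X).
  by apply/le_anti; rewrite le1; exact: Xmin.
by move=> h; rewrite h ltxx in lt.
Qed.
End WeightedLeastSquares.

Theorem theorem3p5 (R : realType) (H : hilbertType R[i]) (p : R) (A W : H -> H)
    (sepH : separable H)
    (bddA : bounded_op A) (closed_rangeA : closed (range A))
    (psdW : psd_op W)
    (p_ge1 : 1 <= p) (sqrtW_Sp : schatten_class p (sqrt_op W)) :
  let f := fun X : H -> H => weighted_norm p W (A \o X \- idfun) in
  let mu := schatten_norm p (sqrt_op (shorted W (range A))) in
  [/\ (exists m, is_minimum_on (@bounded_op R H) f m)
        <-> compatible W (range A),
      compatible W (range A) -> is_minimum_on (@bounded_op R H) f mu
    & compatible W (range A) ->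
        forall X0, bounded_op X0 -> (f X0 = mu <-> W_inverse W A X0)].
Proof.
move=> f mu; have p0 : 0 < p by exact: lt_le_trans p_ge1.
have mu_min : compatible W (range A) -> is_minimum_on (@bounded_op R H) f mu.
  move=> /(compatible_W_inverse psdW bddA closed_rangeA)[X hX].
  have [sX muE] := schatten_norm_resid p0 psdW bddA hX sqrtW_Sp.
  split=> [|Y bY]; first by exists X; [exact: hX.1|].
  rewrite /mu muE /f; have [sY|nsY] := pselect (schatten_class p (resid W A Y)).
    have le x : nrm (resid W A X x) <= nrm (resid W A Y x).
      exact: (W_inverse_leP A psdW hX.1).1 hX x (Y x).
    have [bT _ _] := sX.
    by have [] := schatten_norm_le p0 bT sY le.
  by rewrite /weighted_norm [leRHS]/schatten_norm asboolF// leey.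
split=> //.
  split=> [[m [[X bX fX] minm]]|h]; last by exists mu; exact: mu_min.
  apply: (W_inverse_compatible psdW bddA closed_rangeA (X := X)).
  apply: (minimizer_W_inverse p0) => // Y bY.
  by have -> : schatten_norm p (resid W A X) = m := fX; exact: minm.
move=> h X bX; split=> [fX|hX].
  apply: (minimizer_W_inverse p0) => // Y bY.
  by have -> : schatten_norm p (resid W A X) = mu := fX; exact: (mu_min h).2.
by rewrite /mu (schatten_norm_resid p0 psdW bddA hX sqrtW_Sp).2.
Qed.
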